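(* Let $\beta>0$ and $K>0$, and suppose that $\tilde{\mathcal{E}}_{\beta,K}=\{0\}$. Let $r$ be the type of the global minimum point $z=0$ of $G_{\beta,K}$ (which equals $1$, $2$ or $3$). Then the following hold. (a) As $n\to\infty$, $P_{n,\beta,K}\{S_n/n\in dx\}\Longrightarrow\delta_0$. (b) As $n\to\infty$, $$P_{n,\beta,K}\Big\{\frac{S_n}{n^{1-1/2r}}\in dx\Big\}\Longrightarrow\begin{cases}f_{0,\sigma^2(\beta,K)}(x)\,dx,& r=1,\\ \exp\big(-G_{\beta,K}^{(2r)}(0)\,x^{2r}/(2r)!\big)\,dx,& r=2\text{ or }r=3,\end{cases}$$ where $f_{0,\sigma^2(\beta,K)}$ is the density of a $N(0,\sigma^2(\beta,K))$ random variable with $$\sigma^2(\beta,K)=\frac{2\beta K\,c_\beta''(0)}{G_{\beta,K}''(0)} .$$ When $r=2$ [$K=K_c^{(2)}(\beta)$, $\beta<\beta_c$], $$G^{(4)}_{\beta,K}(0)=-(2\beta K)^4\,\frac{2e^{-\beta}(1+2e^{-\beta})(1-2e^{-\beta}-8e^{-2\beta})}{(1+2e^{-\beta})^4},$$ and when $r=3$ [$K=K_c^{(2)}(\beta)$, $\beta=\beta_c$], $G^{(6)}_{\beta,K}(0)=2\cdot3^4$.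
   Context: Let $\Lambda=\{-1,0,1\}$, $\rho=\frac13(\delta_{-1}+\delta_0+\delta_1)$ and, for $\beta>0$, $\rho_\beta(dy)=\frac{1}{Z(\beta)}e^{-\beta y^2}\rho(dy)$ with $Z(\beta)=\int_\Lambda e^{-\beta y^2}\rho(dy)$. For $\omega=(\omega_1,\dots,\omega_n)\in\Lambda^n$ let $S_n(\omega)=\sum_{j=1}^n\omega_j$, and let $P_{n,\beta}$ be the product measure on $\Lambda^n$ with one-dimensional marginals $\rho_\beta$. The canonical ensemble of the mean-field Blume–Emery–Griffiths model is the probability measure on $\Lambda^n$ $$P_{n,\beta,K}(d\omega)=\frac{1}{\tilde Z_n(\beta,K)}\exp\Big[n\beta K\Big(\frac{S_n(\omega)}{n}\Big)^2\Big]P_{n,\beta}(d\omega),$$ with $\tilde Z_n(\beta,K)$ the normalizing constant. Let $$c_\beta(t)=\log\int_\Lambda e^{ty}\rho_\beta(dy)=\log\Big[\frac{1+e^{-\beta}(e^t+e^{-t})}{1+2e^{-\beta}}\Big],\qquad G_{\beta,K}(z)=\beta Kz^2-c_\beta(2\beta Kz),\ z\in\mathbb{R},$$ and let $\tilde{\mathcal{E}}_{\beta,K}$ be the set of global minimum points of $G_{\beta,K}$ on $\mathbb{R}$. The type of a global minimum point $\tilde z$ is the positive integer $r$ such that $G_{\beta,K}^{(2r)}(\tilde z)>0$ and $G_{\beta,K}(z)=G_{\beta,K}(\tilde z)+\frac{G_{\beta,K}^{(2r)}(\tilde z)}{(2r)!}(z-\tilde z)^{2r}+O((z-\tilde z)^{2r+1})$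 as $z\to\tilde z$. Put $\beta_c=\log4$ and $K_c^{(2)}(\beta)=\frac1{2\beta c_\beta''(0)}=\frac1{4\beta e^{-\beta}}+\frac1{2\beta}$. Notation: for a nonnegative integrable function $f$ on $\mathbb{R}$, $P_{n,\beta,K}\{X_n\in dx\}\Longrightarrow f(x)\,dx$ means that the $P_{n,\beta,K}$-distributions of $X_n$ converge weakly to the probability distribution with density proportional to $f$; $\Longrightarrow\delta_0$ means weak convergence to the point mass at $0$. The exponent $1-1/2r$ means $1-\frac{1}{2r}$. *)

(* Defs.v *)
From HB Require Import structures.
From mathcomp Require Import all_boot all_order all_algebra.
From mathcomp Require Import all_classical all_reals all_analysis.

Set Implicit Arguments.
Unset Strict Implicit.
Unset Printing Implicit Defensive.

Import Order.TTheory GRing.Theory Num.Theory.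
Import numFieldNormedType.Exports.

Local Open Scope classical_set_scope.
Local Open Scope ring_scope.

Definition Lambda := 'I_3.

(* The three elements 0, 1, 2 of 'I_3 encode the spins -1, 0, 1. *)
Definition spin (R : realType) (y : Lambda) : R := (y : nat)%:R - 1.

Definition config (n : nat) := {ffun 'I_n -> Lambda}.

HB.instance Definition _ n := Finite.on (config n).
HB.instance Definition _ n := isPointed.Build (config n) [ffun => ord0].
HB.instance Definition _ n := @isMeasurable.Build default_measure_display
  (config n) discrete_measurable discrete_measurable0
  discrete_measurableC discrete_measurableU.

Section beg_model.
Context {R : realType}.
Implicit Types (beta K t z : R) (y : Lambda) (n : nat).

(* Measures on the finite sets Lambda and config n are given by their point
   masses. *)
Definition rho y : R := 3^-1.

Definition Zrho beta : R := \sum_y expR (- beta * spin R y ^+ 2) * rho y.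

Definition rho_beta beta y : R :=
  expR (- beta * spin R y ^+ 2) * rho y / Zrho beta.

Definition total_spin n (w : config n) : R := \sum_j spin R (w j).

Definition prod_mass n beta (w : config n) : R := \prod_j rho_beta beta (w j).

Definition gibbs_weight n beta K (w : config n) : R :=
  expR (n%:R * beta * K * (total_spin w / n%:R) ^+ 2) * prod_mass beta w.

Definition partition_function n beta K : R :=
  \sum_(w : config n) gibbs_weight beta K w.

Definition ensemble_mass n beta K (w : config n) : R :=
  gibbs_weight beta K w / partition_function n beta K.

Definition ensemble n beta K : set (config n) -> \bar R :=
  fun A => (\sum_(w : config n) (ensemble_mass beta K w)%:E * \d_w A)%E.

Lemma Zrho_gt0 beta : 0 < Zrho beta.
Proof.
rewrite /Zrho (bigD1 ord0)//= ltr_pwDl ?mulr_gt0 ?expR_gt0 ?invr_gt0//.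
by apply: sumr_ge0 => y _; rewrite mulr_ge0 ?expR_ge0// invr_ge0.
Qed.

Lemma gibbs_weight_gt0 n beta K (w : config n) : 0 < gibbs_weight beta K w.
Proof.
rewrite mulr_gt0 ?expR_gt0//; apply: prodr_gt0 => j _.
by rewrite divr_gt0 ?Zrho_gt0// mulr_gt0 ?expR_gt0// invr_gt0.
Qed.

Lemma partition_function_gt0 n beta K : 0 < partition_function n beta K.
Proof.
rewrite /partition_function (bigD1 (point : config n))//=.
rewrite ltr_pwDl ?gibbs_weight_gt0//.
by apply: sumr_ge0 => w _; exact/ltW/gibbs_weight_gt0.
Qed.

Lemma ensemble_mass_ge0 n beta K (w : config n) : 0 <= ensemble_mass beta K w.
Proof. by rewrite divr_ge0// ltW ?gibbs_weight_gt0 ?partition_function_gt0. Qed.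

Section ensemble_probability.
Variables (n : nat) (beta K : R).

Let ensemble0 : @ensemble n beta K set0 = 0%E.
Proof. by rewrite /ensemble big1// => w _; rewrite measure0 mule0. Qed.

Let ensemble_ge0 A : (0 <= @ensemble n beta K A)%E.
Proof.
by apply: sume_ge0 => w _; rewrite mule_ge0// lee_fin ensemble_mass_ge0.
Qed.

Let ensemble_sigma_additive : semi_sigma_additive (@ensemble n beta K).
Proof.
move=> F mF tF mUF.
pose m (w : config n) := mscale (NngNum (ensemble_mass_ge0 beta K w)) (\d_w).
rewrite [X in _ --> X](_ : _ =
    lim ((fun k => \sum_(0 <= i < k) (@ensemble n beta K) (F i))%E @ \oo)).
  by apply: is_cvg_ereal_nneg_natsum => k _; exact: ensemble_ge0.
rewrite nneseries_sum//; last first.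
  by move=> w k _; rewrite mule_ge0// lee_fin ensemble_mass_ge0.
apply: eq_bigr => w _; exact: (@measure_semi_bigcup _ _ _ (m w)).
Qed.

HB.instance Definition _ := isMeasure.Build _ _ _ (@ensemble n beta K)
  ensemble0 ensemble_ge0 ensemble_sigma_additive.

Let ensemble_setT : @ensemble n beta K setT = 1%E.
Proof.
rewrite /ensemble; under eq_bigr do rewrite diracT mule1.
rewrite sumEFin -mulr_suml divff// gt_eqF//.
exact: partition_function_gt0.
Qed.

HB.instance Definition _ := Measure_isProbability.Build _ _ _
  (@ensemble n beta K) ensemble_setT.

End ensemble_probability.

Definition mean_spin n (w : config n) : measurableTypeR R := total_spin w / n%:R.

Definition scaled_spin (gamma : R) n (w : config n)
    : measurableTypeR R :=
  total_spin w / n%:R `^ gamma.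

Lemma measurable_mean_spin n : measurable_fun [set: config n] (@mean_spin n).
Proof. by []. Qed.

Lemma measurable_scaled_spin gamma n :
  measurable_fun [set: config n] (@scaled_spin gamma n).
Proof. by []. Qed.

HB.instance Definition _ n := isMeasurableFun.Build _ _ _ _ (@mean_spin n)
  (@measurable_mean_spin n).
HB.instance Definition _ gamma n := isMeasurableFun.Build _ _ _ _
  (@scaled_spin gamma n) (@measurable_scaled_spin gamma n).

Definition c beta t : R := ln (\sum_y expR (t * spin R y) * rho_beta beta y).

Definition G beta K z : R :=
  beta * K * z ^+ 2 - c beta (2 * beta * K * z).

Definition global_minima (f : R -> R) : set R :=
  [set z | forall x, f z <= f x].

Definition is_type (f : R -> R) z (r : nat) : Prop :=
  [/\ (0 < r)%N, 0 < f^`(2 * r)%classic z &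
   (fun x => f x - (f z + f^`(2 * r)%classic z / (2 * r)`!%:R
                            * (x - z) ^+ (2 * r)))
     =O_ (nbhs z) (fun x => (x - z) ^+ (2 * r).+1)].

Definition beta_c : R := ln 4.

Definition Kc2 beta : R := (2 * beta * (c beta)^`(2)%classic 0)^-1.

Definition sigma2 beta K : R :=
  2 * beta * K * (c beta)^`(2)%classic 0 / (G beta K)^`(2)%classic 0.

(* Laws on the line live on measurableTypeR R, the Borel structure carried by
   lebesgue_measure and normal_prob; the default instance on R has the same
   measurable sets under another display. *)
Definition weak_cvg (mu : nat -> probability (measurableTypeR R) R)
    (nu : probability (measurableTypeR R) R) : Prop :=
  forall g : R -> R, continuous g -> (exists M, forall x, `|g x| <= M) ->
    (\int[mu n]_x (g x)%:E)%E @[n --> \oo] --> (\int[nu]_x (g x)%:E)%E.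

(* nu has density proportional to f: since nu has total mass 1, a is
   necessarily the inverse of the integral of f. *)
Definition has_density_prop (nu : probability (measurableTypeR R) R)
    (f : R -> R) : Prop :=
  exists2 a : R, 0 < a &
  forall A : set (measurableTypeR R), measurable A ->
    nu A = (\int[lebesgue_measure]_(x in A) (a * f x)%:E)%E.

Definition weak_cvg_density (mu : nat -> probability (measurableTypeR R) R)
    (f : R -> R) : Prop :=
  exists2 nu : probability (measurableTypeR R) R,
    has_density_prop nu f & weak_cvg mu nu.

End beg_model.

(* Main.v *)
Require Import Defs.
From HB Require Import structures.
From mathcomp Require Import all_boot all_order all_algebra.
From mathcomp Require Import all_classical all_reals all_analysis.
From mathcomp Require Import measurable_realfun.
From mathcomp Require Import complex.
From mathcomp Require Import ring lra.

Set Implicit Arguments.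
Unset Strict Implicit.
Unset Printing Implicit Defensive.

Import Order.TTheory GRing.Theory Num.Theory.
Import numFieldNormedType.Exports.

Local Open Scope classical_set_scope.
Local Open Scope ring_scope.

(* Write b = n^(1/2r) and X = S_n b / n.  Completing the square
   (Hubbard-Stratonovich) shows that X plus an independent centered Gaussian of
   variance b^2 / (2 beta K n) has density proportional to
   exp (- n G (x / b)).  Near 0, G (z) = kappa z^(2r) + O (z^(2r+1)), and away
   from 0 it dominates a multiple of z^2 because 0 is its only minimum, so by
   dominated convergence these densities converge, unnormalized, to
   exp (- kappa x^(2r)).

   If r >= 2 the added Gaussian tends to 0 and can be removed.  If r = 1 its
   variance does not tend to 0; then X = S_n / sqrt n, its law is the law of
   S_n / sqrt n under the product measure reweighted by exp (beta K x^2) / Z_n,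
   so the central limit theorem for the product measure handles the numerator
   and the first argument handles Z_n.  That central limit theorem is proved on
   compactly supported functions by mollifying with a Gaussian, which is an
   integral of cosines, and by computing the characteristic function.

   The type is read off the cumulants of rho_beta, the even ones being
   polynomials in its variance. *)

(** * Gaussian integrals *)

(** For r = 1 the obstacle is that the weight exp (beta K x^2) is unbounded, so weak convergence
    under the product measure does not by itself pass to the reweighted masses. Multiplied by a
    continuous compactly supported h, the weight becomes another such function; hence both cases are
    first proved for these test functions, while the total mass Z_n is controlled separately by the
    Laplace asymptotics.

    No mass is lost in this restriction: the limit density integrates to exactly 1, so convergence
    on compactly supported cutoffs already forces tightness, and tightness extends the convergence
    to all bounded continuous functions. Part (a) is then a corollary of (b), since S_n / n is X / b
    with X tight and 1 / b tending to 0.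

    Derivatives are needed up to order 7 because the remainder for r = 3 has order 2r + 1. *)

Section gaussian_domination.
Context {R : realType}.
Implicit Types (a b m x C : R) (f g : R -> R).
Local Notation mu := (@lebesgue_measure R).

(** Gaussians are parametrized throughout by the coefficient [a] of the exponent (variance 1 /
    (2a)), the quantity on which completing the square and Fourier inversion act. *)
Lemma normal_fun_expR a m : 0 < a ->
  normal_fun m (Num.sqrt (2 * a)^-1) = fun x => expR (- a * (x - m) ^+ 2).
Proof.
move=> a0; apply/funext => x; rewrite /normal_fun sqr_sqrtr; last first.
  by rewrite invr_ge0 mulr_ge0// ltW.
by congr expR; field; rewrite gt_eqF.
Qed.

Lemma normal_pdf_expR a m : 0 < a ->
  normal_pdf m (Num.sqrt (2 * a)^-1) =
  fun x => Num.sqrt (a / pi) * expR (- a * (x - m) ^+ 2).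
Proof.
move=> a0; have s0 : Num.sqrt (2 * a)^-1 != 0 :> R.
  by rewrite sqrtr_eq0 -ltNge invr_gt0 mulr_gt0.
rewrite normal_pdfE// normal_fun_expR//; apply/funext => x; congr (_ * _).
rewrite /normal_peak sqr_sqrtr; last by rewrite invr_ge0 mulr_ge0// ltW.
rewrite -sqrtrV; last first.
  by rewrite mulrn_wge0// mulr_ge0 ?pi_ge0// invr_ge0 mulr_ge0// ltW.
congr Num.sqrt; have := pi_gt0 R; move: pi => p p0.
by field; rewrite !gt_eqF.
Qed.

Lemma integrable_gauss a m : 0 < a ->
  mu.-integrable setT (EFin \o (fun x => expR (- a * (x - m) ^+ 2))).
Proof.
move=> a0; have := integrable_normal_pdf m (Num.sqrt (2 * a)^-1).
rewrite normal_pdf_expR// => /(integrableZl measurableT (Num.sqrt (a / pi))^-1).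
apply: eq_integrable => // x _ /=.
by rewrite -EFinM mulKf// sqrtr_eq0 -ltNge divr_gt0 ?pi_gt0.
Qed.

Lemma Rintegral_gauss a m : 0 < a ->
  \int[mu]_x expR (- a * (x - m) ^+ 2) = Num.sqrt (pi / a).
Proof.
move=> a0; have s0 : 0 < Num.sqrt (a / pi) by rewrite sqrtr_gt0 divr_gt0 ?pi_gt0.
have := integral_normal_pdf m (Num.sqrt (2 * a)^-1).
rewrite normal_pdf_expR// => /(congr1 fine).
rewrite -/(Rintegral _ _ _) RintegralZl//; last exact: integrable_gauss.
move=> /= /(canRL (mulKf (lt0r_neq0 s0))) ->.
by rewrite mulr1 -sqrtrV ?divr_ge0 ?pi_ge0 ?ltW// invf_div.
Qed.

(** A class closed under sums and bounded measurable factors that provides integrability and a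
    majorant for dominated convergence at once. *)
Definition gaussian_dominated f := measurable_fun setT f /\
  exists C, exists2 a, 0 < a & forall x, `|f x| <= C * expR (- a * x ^+ 2).

Lemma gaussian_dominated_integrable f : gaussian_dominated f ->
  mu.-integrable setT (EFin \o f).
Proof.
move=> [mf [C [a a0 fC]]].
have /(integrableZl measurableT C) := integrable_gauss 0 a0.
apply: le_integrable => //; first exact/measurable_EFinP.
move=> x _ /=; rewrite lee_fin subr0 (le_trans (fC x))//.
exact: ler_norm.
Qed.

Lemma gaussian_dominatedM f g C : measurable_fun setT f ->
  (forall x, `|f x| <= C) -> gaussian_dominated g ->
  gaussian_dominated (fun x => f x * g x).
Proof.
move=> mf fC [mg [D [a a0 gD]]]; split; first exact: measurable_funM.
exists (C * D), a => // x; rewrite normrM -mulrA ler_pM//.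
Qed.

Lemma gaussian_dominatedN f : gaussian_dominated f ->
  gaussian_dominated (fun x => - f x).
Proof.
move=> [mf [C [a a0 fC]]]; split; first exact: measurableT_comp.
by exists C, a => // x; rewrite normrN.
Qed.

Lemma gaussian_dominatedD f g : gaussian_dominated f -> gaussian_dominated g ->
  gaussian_dominated (fun x => f x + g x).
Proof.
move=> [mf [C [a a0 fC]]] [mg [D [b b0 gD]]]; split.
  exact: measurable_funD.
exists (`|C| + `|D|), (Num.min a b); first by rewrite lt_min a0.
move=> x; apply: (le_trans (ler_normD _ _)); rewrite mulrDl.
have bd c E : Num.min a b <= c -> E * expR (- c * x ^+ 2) <=
    `|E| * expR (- Num.min a b * x ^+ 2).
  move=> mc; apply: (@le_trans _ _ (`|E| * expR (- c * x ^+ 2))).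
    by rewrite ler_wpM2r ?expR_ge0// ler_norm.
  by rewrite ler_wpM2l// ler_expR !mulNr lerN2 ler_wpM2r// sqr_ge0.
apply: lerD.
  by apply: (le_trans (fC x)); apply: bd; rewrite ge_min lexx.
by apply: (le_trans (gD x)); apply: bd; rewrite ge_min lexx orbT.
Qed.

End gaussian_domination.

Section real_lemmas.
Context {R : realType}.
Implicit Types (a b m x C : R) (f g : R -> R).
Local Notation mu := (@lebesgue_measure R).

Lemma measurable_gauss a m :
  measurable_fun setT (fun x : R => expR (- a * (x - m) ^+ 2)).
Proof.
apply: measurableT_comp => //; apply: measurable_funM => //.
by apply: measurable_funX; exact: measurable_funB.
Qed.

Lemma gaussian_dominated_shift a m : 0 < a ->
  gaussian_dominated (fun x => expR (- a * (x - m) ^+ 2)).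
Proof.
move=> a0; split; first exact: measurable_gauss.
(* Halving the rate absorbs the cross term: the exponents then differ by the square a/2 (x -
   2m)^2. *)
exists (expR (a * m ^+ 2)), (a / 2); first by rewrite divr_gt0.
move=> x; rewrite ger0_norm ?expR_ge0// -expRD ler_expR -subr_ge0.
rewrite (_ : _ - _ = a / 2 * (x - 2 * m) ^+ 2); last by field.
by rewrite mulr_ge0 ?sqr_ge0// ltW// divr_gt0.
Qed.

(** The bound is asked only for positive [n], because the integrands of the model divide by [n]; the
    proof therefore shifts the sequence by one. The limit inherits the majorant pointwise. *)
Lemma dominated_cvg_Rintegral (f_ : nat -> R -> R) f a C : 0 < a ->
  (forall n, measurable_fun setT (f_ n)) ->
  (forall x, f_ n x @[n --> \oo] --> f x) ->
  (forall n x, (0 < n)%N -> `|f_ n x| <= C * expR (- a * x ^+ 2)) ->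
  gaussian_dominated f /\
  \int[mu]_x f_ n x @[n --> \oo] --> \int[mu]_x f x.
Proof.
move=> a0 mf fcvg fC.
have fE x : (f_ n.+1 x)%:E @[n --> \oo] --> (f x)%:E.
  by apply: cvg_EFin; [exact: nearW | rewrite (cvg_shiftS (f_ ^~ x))].
have gf : gaussian_dominated f.
  split.
    apply/measurable_EFinP.
    apply: (@emeasurable_fun_cvg _ _ R _ (fun n x => (f_ n.+1 x)%:E)) => //.
    by move=> n; exact/measurable_EFinP.
  exists C, a => // x.
  have fx : `|f_ n.+1 x| @[n --> \oo] --> `|f x|.
    by apply: cvg_norm; rewrite (cvg_shiftS (f_ ^~ x)).
  rewrite -(cvg_lim _ fx)//; apply: limr_le; first by apply/cvg_ex; eexists; exact: fx.
  by apply: nearW => n; exact: fC.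
split=> //; rewrite -(cvg_shiftS (fun n => \int[mu]_x f_ n x)).
apply: fine_cvg; rewrite fineK; last first.
  exact/integrable_fin_num/gaussian_dominated_integrable.
apply: (@dominated_cvg _ _ _ mu _ _ (fun n x => (f_ n.+1 x)%:E) _
  (EFin \o (fun x => C * expR (- a * (x - 0) ^+ 2)))) => //.
- by move=> n; apply/measurable_EFinP; exact: mf.
- apply: gaussian_dominated_integrable.
  apply: (@gaussian_dominatedM _ (cst C) _ `|C|) => //.
  exact: gaussian_dominated_shift.
- by move=> n x _; rewrite /= lee_fin subr0 fC.
Qed.

Lemma is_derive_continuous f : (forall x, exists a, is_derive x 1 f a) ->
  continuous f.
Proof.
move=> df x; have [a [fx _]] := df x.
exact/differentiable_continuous/derivable1_diffP.
Qed.

End real_lemmas.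

(** * Fourier transform of a Gaussian *)

Section fourier.
Context {R : realType}.
Implicit Types (a b m x C u : R) (f g : R -> R).
Local Notation mu := (@lebesgue_measure R).

Lemma measurable_is_derive f (df : R -> R) : (forall x, is_derive x 1 f (df x)) ->
  measurable_fun setT f.
Proof.
move=> dfx; apply: continuous_measurable_fun; apply: is_derive_continuous => x.
by exists (df x).
Qed.

Lemma cvg_natV : (n%:R : R)^-1 @[n --> \oo] --> (0 : R).
Proof.
rewrite gtr0_cvgV0; first exact: cvgr_idn.
by near=> n; rewrite ltr0n; near: n; exact: nbhs_infty_gt.
Unshelve. all: by end_near. Qed.

(** The fundamental theorem of calculus on [-n, n]: the boundary values of [f] vanish in the limit
    by Gaussian decay. *)
Lemma Rintegral_derive_eq0 f g : (forall x, is_derive x 1 f (g x)) ->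
  continuous g -> gaussian_dominated f -> gaussian_dominated g ->
  \int[mu]_x g x = 0.
Proof.
move=> fg cg [_ [C [a a0 fC]]] [mg [D [b b0 gD]]].
pose A n : set R := `[(- n%:R)%R, n%:R%R]%classic.
pose g_ n := g \_ (A n).
have cf : continuous f by apply: is_derive_continuous => x; exists (g x).
have gE n : (0 < n)%N -> \int[mu]_x g_ n x = f n%:R - f (- n%:R).
  move=> n0; rewrite -Rintegral_mkcond /Rintegral (@continuous_FTC2 _ _ f)//.
  - by rewrite -subr_gt0 opprK addr_gt0 ?ltr0n.
  - exact/continuous_subspaceT.
  - by split=> [x _||]; [case: (fg x)|exact/cvg_at_right_filter/cf|
      exact/cvg_at_left_filter/cf].
  - by move=> x _; rewrite derive1E; case: (fg x).
have gb n x : `|g_ n x| <= D * expR (- b * x ^+ 2).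
  by rewrite /g_ patchE; case: ifPn => // _; rewrite normr0 (le_trans _ (gD x)).
have [mg_ cvg_g_] : (forall n, measurable_fun setT (g_ n)) /\
    (forall x, g_ n x @[n --> \oo] --> g x).
  split=> [n|x].
    by apply: (measurable_restrictT g _).1; [exact: measurable_itv|exact: measurable_funTS].
  apply: cvg_near_cst; near=> n.
  rewrite /g_ patchE mem_set// /A/= in_itv/= -ler_norml.
  near: n; exact: nbhs_infty_ger.
have [_] := dominated_cvg_Rintegral b0 mg_ cvg_g_ (fun n x _ => gb n x).
have f0 s : s = 1 \/ s = -1 -> f (s * n%:R) @[n --> \oo] --> 0.
  move=> s1; apply: norm_cvg0.
  (* From exp y >= 1 + y, exp (- a n^2) <= 1 / (a n^2) <= 1 / (a n) for n >= 1. *)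
  apply: (@squeeze_cvgr _ _ _ _ (cst 0) (fun n => `|C| * (a^-1 * n%:R^-1))).
  - near=> n; rewrite normr_ge0/= (le_trans (fC _))//.
    apply: (@le_trans _ _ (`|C| * expR (- a * (s * n%:R) ^+ 2))).
      by rewrite ler_wpM2r ?expR_ge0// ler_norm.
    rewrite ler_wpM2l// exprMn.
    have -> : s ^+ 2 = 1 by case: s1 => ->; rewrite ?expr1n ?sqrrN ?expr1n.
    have n0 : 0 < n%:R :> R by rewrite ltr0n; near: n; exact: nbhs_infty_gt.
    rewrite mul1r mulNr expRN -invfM lef_pV2 ?posrE ?expR_gt0 ?mulr_gt0//.
    apply: le_trans (expR_ge1Dx _); rewrite -[leLHS]add0r lerD// ler_pM2l//.
    by rewrite -[leLHS]mulr1 expr2 ler_pM2l// ler1n -(ltr0n R).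
  - exact: cvg_cst.
  - rewrite -[X in _ --> X](mulr0 `|C|); apply: cvgM; first exact: cvg_cst.
    rewrite -[X in _ --> X](mulr0 a^-1); apply: cvgM; first exact: cvg_cst.
    exact: cvg_natV.
move=> lim1.
have lim2 : \int[mu]_x g_ n x @[n --> \oo] --> 0 - 0.
  have : f n%:R - f (- n%:R) @[n --> \oo] --> 0 - 0.
    apply: cvgB; first by under eq_fun do rewrite -[_%:R]mul1r; apply: f0; left.
    by under eq_fun do rewrite -mulN1r; apply: f0; right.
  apply: cvg_trans; apply: near_eq_cvg; near=> n.
  by rewrite gE//; near: n; exact: nbhs_infty_gt.
rewrite subr0 in lim2; exact: (cvg_unique (@Rhausdorff R) lim1 lim2).
Unshelve. all: by end_near. Qed.

Lemma integrable_gaussM a f C : 0 < a -> measurable_fun setT f ->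
  (forall x, `|f x| <= C) ->
  mu.-integrable setT (EFin \o (fun t => expR (- a * t ^+ 2) * f t)).
Proof.
move=> a0 mf fC; apply: gaussian_dominated_integrable.
have := @gaussian_dominatedM _ f (fun t => expR (- a * (t - 0) ^+ 2)) C mf fC.
move=> /(_ (gaussian_dominated_shift 0 a0)).
by congr gaussian_dominated; apply/funext => t; rewrite subr0 mulrC.
Qed.

Lemma gaussian_dominated_mulX a : 0 < a ->
  gaussian_dominated (fun t => t * expR (- a * t ^+ 2)).
Proof.
move=> a0; split.
  apply: (@measurable_is_derive _ (fun t => expR (- a * t ^+ 2) * (1 - 2 * a * t ^+ 2))) => t.
  by apply: is_derive_eq; rewrite /GRing.scale/=; ring.
(* The constant comes from |t| <= 1 + t^2, where 1 and a t^2 / 2 are each at most exp (a t^2 /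
   2). *)
exists (1 + 2 / a), (a / 2); first by rewrite divr_gt0.
move=> t; rewrite normrM (ger0_norm (expR_ge0 _)).
have -> : - a * t ^+ 2 = a / 2 * t ^+ 2 * -1 + - (a / 2) * t ^+ 2 by field.
rewrite expRD mulrA ler_wpM2r ?expR_ge0// mulrN1 expRN ler_pdivrMr ?expR_gt0//.
have t1 : `|t| <= 1 + t ^+ 2.
  rewrite -(ger0_norm (sqr_ge0 t)) normrX -subr_ge0.
  rewrite (_ : _ - _ = (`|t| - 2^-1) ^+ 2 + 3 / 4); last by field.
  by rewrite addr_ge0 ?sqr_ge0// divr_ge0.
apply: (le_trans t1); rewrite mulrDl mul1r.
have e1 := expR_ge1Dx (a / 2 * t ^+ 2).
have q0 : 0 <= a / 2 * t ^+ 2 by rewrite mulr_ge0 ?sqr_ge0// divr_ge0// ltW.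
apply: lerD; first by apply: le_trans e1; rewrite lerDl.
rewrite [leLHS](_ : t ^+ 2 = 2 / a * (a / 2 * t ^+ 2)); last by field; rewrite gt_eqF.
rewrite ler_wpM2l//; first by rewrite divr_ge0// ltW.
by apply: le_trans e1; rewrite lerDr.
Qed.

Lemma gaussian_dominatedMr f g C : measurable_fun setT f ->
  (forall x, `|f x| <= C) -> gaussian_dominated g ->
  gaussian_dominated (fun x => g x * f x).
Proof.
move=> mf fC /(gaussian_dominatedM mf fC).
by congr gaussian_dominated; apply/funext => x; rewrite mulrC.
Qed.

Lemma gaussian_dominated_gauss a : 0 < a ->
  gaussian_dominated (fun x => expR (- a * x ^+ 2)).
Proof.
move=> /(gaussian_dominated_shift 0).
by congr gaussian_dominated; apply/funext => x; rewrite subr0.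
Qed.

(** Differentiation under the integral and integration by parts give F'(v) = - v / (2a) F(v), so
    F(v) exp (v^2 / (4a)) is constant, and F(0) is the Gaussian integral. *)
Lemma gauss_fourier a u : 0 < a ->
  \int[mu]_t (expR (- a * t ^+ 2) * cos (t * u)) =
  Num.sqrt (pi / a) * expR (- (4 * a)^-1 * u ^+ 2).
Proof.
move=> a0.
have a_neq0 : a != 0 by rewrite gt_eqF.
pose f (v t : R) := expR (- a * t ^+ 2) * cos (t * v).
pose F v := \int[mu]_t f v t.
have mcos v : measurable_fun setT (fun t : R => cos (t * v)).
  by apply: (@measurable_is_derive _ (fun t => - sin (t * v) * v)) => t;
    apply: is_derive_eq; rewrite /GRing.scale/=; ring.
have msin v : measurable_fun setT (fun t : R => sin (t * v)).
  by apply: (@measurable_is_derive _ (fun t => cos (t * v) * v)) => t;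
    apply: is_derive_eq; rewrite /GRing.scale/=; ring.
have intf v : mu.-integrable setT (EFin \o f v).
  by apply: (@integrable_gaussM _ _ 1) => // t; exact: cos_max.
have dg (v t : R) : is_derive t 1 (fun t => expR (- a * t ^+ 2) * sin (t * v))
    (expR (- a * t ^+ 2) * (v * cos (t * v)) -
     2 * a * (t * expR (- a * t ^+ 2) * sin (t * v))).
  by apply: is_derive_eq; rewrite /GRing.scale/=; ring.
(* The derivative of the integrand in the integration by parts, computed to obtain its
   continuity. *)
pose dgv (v t : R) := expR (- a * t ^+ 2) *
  ((4 * a ^+ 2 * t ^+ 2 - v ^+ 2 - 2 * a) * sin (t * v) -
   4 * a * t * v * cos (t * v)).
have ddg (v t : R) : is_derive t 1 (fun t => expR (- a * t ^+ 2) * (v * cos (t * v)) -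
     2 * a * (t * expR (- a * t ^+ 2) * sin (t * v))) (dgv v t).
  by apply: is_derive_eq; rewrite /dgv /GRing.scale/=; ring.
have dexp (v : R) : is_derive v 1 (fun v : R => expR ((4 * a)^-1 * v ^+ 2))
    (v / (2 * a) * expR ((4 * a)^-1 * v ^+ 2)).
  by apply: is_derive_eq; rewrite /GRing.scale/=; field.
have d1f (v t : R) : is_derive v 1 (f ^~ t) (- (t * expR (- a * t ^+ 2) * sin (t * v))).
  by rewrite /f; apply: is_derive_eq; rewrite /GRing.scale/=; ring.
have d1fE (v t : R) : partial1of2 f v t = - (t * expR (- a * t ^+ 2) * sin (t * v)).
  by rewrite partial1of2E; case: (d1f v t).
have domG := gaussian_dominated_mulX a0.
have dF (v : R) : is_derive v 1 F (\int[mu]_t partial1of2 f v t).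
  have vI : `](v - 1), (v + 1)[%classic v by rewrite /= in_itv/= ltrBlDr ltrDl ltr01.
  have intf' w : `](v - 1), (v + 1)[%classic w -> mu.-integrable setT (EFin \o f w) by [].
  have der w t : `](v - 1), (v + 1)[%classic w -> [set: R] t -> derivable (f ^~ t) w 1.
    by move=> _ _; case: (d1f w t).
  have intG : mu.-integrable setT (EFin \o (fun t => `|t * expR (- a * t ^+ 2)|)).
    apply: gaussian_dominated_integrable; case: domG => mG [C [b b0 GC]].
    split; first exact: measurableT_comp.
    by exists C, b => // t; rewrite normr_id.
  have ub w t : `](v - 1), (v + 1)[%classic w -> [set: R] t ->
      `|partial1of2 f w t| <= `|t * expR (- a * t ^+ 2)|.
    by move=> _ _; rewrite d1fE normrN normrM ler_piMr// sin_max.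
  apply: DeriveDef.
    exact: (derivable_under_integral measurableT vI intf' der _ intG ub).
  rewrite -derive1E.
  exact: (differentiation_under_integral measurableT vI intf' der _ intG ub).
have dFE v : \int[mu]_t partial1of2 f v t = - (v / (2 * a)) * F v.
  pose g (t : R) := expR (- a * t ^+ 2) * (v * cos (t * v)) -
    2 * a * (t * expR (- a * t ^+ 2) * sin (t * v)).
  (* [g] is the t-derivative of exp (- a t^2) sin (t v); its vanishing integral reads v F(v) = 2a S,
     with F'(v) = - S. *)
  have ibp : \int[mu]_t g t = 0.
    apply: (Rintegral_derive_eq0 (dg v)); rewrite /g.
    - by apply: is_derive_continuous => t; exists (dgv v t); exact: ddg.
    - exact: gaussian_dominatedMr (msin v) (fun=> sin_max _) (gaussian_dominated_gauss a0).
    - apply: gaussian_dominatedD.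
        apply: (@gaussian_dominatedMr _ _ `|v|) (gaussian_dominated_gauss a0).
          exact: measurable_funM.
        by move=> x; rewrite normrM ler_piMr// cos_max.
      apply: gaussian_dominatedN.
      apply: (@gaussian_dominatedM _ (cst (2 * a)) _ `|2 * a|) => //.
      exact: gaussian_dominatedMr (msin v) (fun=> sin_max _) domG.
  pose S := \int[mu]_t (t * expR (- a * t ^+ 2) * sin (t * v)).
  have intS : mu.-integrable setT
      (EFin \o (fun t => t * expR (- a * t ^+ 2) * sin (t * v))).
    apply: gaussian_dominated_integrable.
    exact: gaussian_dominatedMr (msin v) (fun=> sin_max _) domG.
  have -> : \int[mu]_t partial1of2 f v t = - S.
    rewrite -mulN1r -RintegralZl//; apply: eq_Rintegral => t _.
    by rewrite d1fE mulN1r.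
  suff : v * F v - 2 * a * S = 0.
    move=> /subr0_eq e; apply: (mulfI (_ : 2 * a != 0)); first by rewrite mulf_neq0.
    rewrite mulrN -e; field.
    exact: a_neq0.
  have -> : v * F v = \int[mu]_t (v * f v t) by rewrite RintegralZl.
  have -> : 2 * a * S = \int[mu]_t (2 * a * (t * expR (- a * t ^+ 2) * sin (t * v))).
    by rewrite RintegralZl.
  rewrite -ibp -RintegralB//.
  - by apply: eq_Rintegral => t _; rewrite /f /g; ring.
  - by have /(integrableZl measurableT v) := intf v.
  - by have /(integrableZl measurableT (2 * a)) := intS.
have cst v : F v * expR ((4 * a)^-1 * v ^+ 2) = F 0.
  transitivity (F 0 * expR ((4 * a)^-1 * 0 ^+ 2)); last first.
    by rewrite expr0n mulr0 expR0 mulr1.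
  apply: (@is_derive_0_is_cst _ (fun v => F v * expR ((4 * a)^-1 * v ^+ 2))) => {}v.
  have := dF v; rewrite dFE => dFv.
  have := @is_deriveM _ _ _ _ _ _ _ _ dFv (dexp v).
  congr is_derive; rewrite /GRing.scale/=; ring.
rewrite -/(F u) mulNr expRN; apply: (canRL (mulfK (lt0r_neq0 (expR_gt0 _)))).
rewrite cst -(Rintegral_gauss 0 a0); apply: eq_Rintegral => t _.
by rewrite /f mulr0 cos0 mulr1 subr0.
Qed.

End fourier.

(** * Compactly supported functions and mollification *)

Section compact_support.
Context {R : realType}.
Implicit Types (f g : R -> R) (M e a m x X : R).
Local Notation mu := (@lebesgue_measure R).

Definition compactly_supported f := exists M, forall x, M <= `|x| -> f x = 0.

Lemma compact_support_bounded f : continuous f -> compactly_supported f ->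
  exists2 B, 0 <= B & forall x, `|f x| <= B.
Proof.
move=> cf [M fM]; pose N := `|M|.
have [||c cN fc] := @EVT_max R (fun x => `|f x|) (- N) N.
- by rewrite -subr_ge0 opprK /N addr_ge0.
- apply: continuous_subspaceT => x; apply: cvg_norm; exact: cf.
exists `|f c| => // x; have [xN|Nx] := leP `|x| N.
  by apply: fc; rewrite in_itv/= -ler_norml.
by rewrite fM ?normr0// (le_trans (ler_norm M))// ltW.
Qed.

(** Compactness gives one [d] for all x in [-M, M]. By symmetry this covers every pair with a point
    there, and for the other pairs both values vanish. *)
Lemma compact_support_unif_continuous f e : continuous f ->
  compactly_supported f -> 0 < e ->
  exists2 d, 0 < d & forall x y, `|x - y| < d -> `|f x - f y| <= e.
Proof.
move=> cf [M fM] e0.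
have : \forall d \near (0 : R)^'+, `[- M, M]%classic `<=`
    (fun x => forall y, `|x - y| < d -> `|f x - f y| <= e).
  have /compact_near_coveringP := @segment_compact R (- M) M; apply => x _.
  have /cvgrPdist_lt/(_ (e / 2)) := cf x; rewrite divr_gt0// => /(_ isT).
  move=> /nbhs_ballP[d /= d0 fd].
  exists (ball x (d / 2), [set t | t < d / 2]) => /=.
    split; first by apply: nbhsx_ballx; rewrite divr_gt0.
    by apply: nbhs_right_lt; rewrite divr_gt0.
  move=> [x' t] /= [xx' td] y x'y.
  rewrite -(subrKA (f x)) [e]splitr (le_trans (ler_normD _ _))// lerD// ltW//.
    rewrite distrC; apply: fd; apply: le_ball xx'.
    by rewrite ler_pdivrMr// ler_peMr ?ltW// ltr1n.
  apply: fd; rewrite /ball/= -(subrKA x') (le_lt_trans (ler_normD _ _))//.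
  by rewrite [d]splitr ltrD// (lt_trans x'y).
move=> /(filterI (nbhs_right_gt 0))/filter_ex[d [/= d0 fd]].
exists d => // x y xy; have [xM|Mx] := leP `|x| M.
  by apply: fd => //=; rewrite in_itv/= -ler_norml.
have [yM|My] := leP `|y| M.
  by rewrite distrC; apply: fd; rewrite /= ?in_itv/= -?ler_norml// distrC.
by rewrite !fM ?subrr ?normr0 ?ltW.
Qed.

(** The threshold [A] is uniform in [X], since the estimate is later averaged over all values of the
    spin sum. Within distance [d] of [X] uniform continuity applies; beyond it, half of the exponent
    is spent on exp (- Y) <= 1 / Y <= 2 / (a d^2) and the other half keeps the kernel integrable. *)
Lemma mollification_error f B e : measurable_fun setT f -> 
  (forall x, `|f x| <= B) ->
  (forall e, 0 < e ->
    exists2 d, 0 < d & forall x y, `|x - y| < d -> `|f x - f y| <= e) ->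
  0 < e ->
  exists2 A, 0 < A & forall a X, A <= a ->
    `|Num.sqrt (a / pi) * \int[mu]_x (f x * expR (- a * (x - X) ^+ 2)) - f X|
      <= e.
Proof.
move=> mf fB uf e0; have [d d0 fd] := uf (e / 2) (divr_gt0 e0 (ltr0n _ 2)).
have B0 : 0 <= B by rewrite (le_trans _ (fB 0)).
have q0 : 0 < 16 * B / d ^+ 2 + 1.
  by apply: ltr_wpDl => //; apply: divr_ge0; [exact: mulr_ge0|exact: sqr_ge0].
(* The tail will contribute at most 8 B / (a d^2), which is at most e / 2 once a >= 16 B / (d^2 e);
   the added 1 keeps [A] positive when B = 0. *)
exists ((16 * B / d ^+ 2 + 1) / e); first exact: divr_gt0.
move=> a X; rewrite ler_pdivrMr// => Aa.
have a0 : 0 < a.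
  by rewrite -(pmulr_lgt0 _ e0); apply: lt_le_trans Aa.
have s0 : 0 < Num.sqrt (a / pi) by rewrite sqrtr_gt0 divr_gt0// pi_gt0.
have sK : Num.sqrt (a / pi) * Num.sqrt (pi / a) = 1.
  rewrite -sqrtrM ?divr_ge0 ?pi_ge0 ?ltW//.
  by rewrite -[a / pi]invf_div mulVf ?sqrtr1// gt_eqF// divr_gt0 ?pi_gt0.
pose K b x := expR (- b * (x - X) ^+ 2) : R.
have iK b : 0 < b -> mu.-integrable setT (EFin \o K b) by exact: integrable_gauss.
have iKZ b c : 0 < b -> mu.-integrable setT (EFin \o (fun x => c * K b x)).
  by move=> /iK /(integrableZl measurableT c).
have ifK : mu.-integrable setT (EFin \o (fun x => f x * K a x)).
  apply: gaussian_dominated_integrable.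
  exact: gaussian_dominatedM mf fB (gaussian_dominated_shift X a0).
have -> : f X = Num.sqrt (a / pi) * \int[mu]_x (f X * K a x).
  by rewrite RintegralZl ?Rintegral_gauss ?iK// mulrCA sK mulr1.
rewrite -mulrBr -RintegralB ?iKZ// normrM (gtr0_norm s0).
have a20 : 0 < a / 2 by rewrite divr_gt0.
pose c := 2 * B / d ^+ 2 * (2 / a).
have c0 : 0 <= c by rewrite mulr_ge0// divr_ge0 ?mulr_ge0 ?sqr_ge0// ltW.
have le1 : `|\int[mu]_x (f x * K a x - f X * K a x)| <=
    \int[mu]_x (e / 2 * K a x + c * K (a / 2) x).
  have iB : mu.-integrable setT (EFin \o (fun x => f x * K a x - f X * K a x)).
    by have := integrableB measurableT ifK (iKZ a (f X) a0).
  apply: (le_trans (le_normr_Rintegral measurableT iB)).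
  apply: le_Rintegral => //.
  - by have := integrable_norm iB.
  - by have := integrableD measurableT (iKZ a (e / 2) a0) (iKZ (a / 2) c a20).
  move=> x _; rewrite -mulrBl normrM (ger0_norm (expR_ge0 _)) -/(K a x).
  have [xd|dx] := ltP `|x - X| d.
    apply: (@le_trans _ _ (e / 2 * K a x)).
      by rewrite ler_wpM2r ?expR_ge0// fd.
    by rewrite lerDl mulr_ge0// expR_ge0.
  apply: (@le_trans _ _ (c * K (a / 2) x)); last first.
    by rewrite lerDr mulr_ge0 ?expR_ge0// divr_ge0// ltW.
  have -> : K a x = K (a / 2) x * expR (- (a / 2 * (x - X) ^+ 2)).
    by rewrite -expRD; congr expR; field.
  rewrite mulrCA [leRHS]mulrC ler_wpM2l ?expR_ge0//.
  apply: (@le_trans _ _ (2 * B * expR (- (a / 2 * (x - X) ^+ 2)))).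
    rewrite ler_wpM2r ?expR_ge0// (le_trans (ler_normB _ _))//.
    by rewrite mulr2n mulrDl mul1r lerD.
  set Y := a / 2 * (x - X) ^+ 2; rewrite /c -!mulrA ler_wpM2l// ler_wpM2l// expRN.
  rewrite -[leLHS]mul1r ler_pdivrMr ?expR_gt0//.
  have e1 := expR_ge1Dx Y.
  rewrite [leRHS](_ : _ = (d ^+ 2)^-1 * (2 / a) * expR Y); last by ring.
  apply: (@le_trans _ _ ((d ^+ 2)^-1 * (2 / a) * Y)).
    rewrite [leRHS](_ : _ = (x - X) ^+ 2 / d ^+ 2); last first.
      by rewrite /Y; field; rewrite !gt_eqF.
    rewrite ler_pdivlMr ?exprn_gt0// mul1r -(ger0_norm (sqr_ge0 (x - X))) normrX.
    by rewrite lerXn2r// nnegrE// ltW.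
  rewrite ler_wpM2l//; first by rewrite mulr_ge0 ?invr_ge0 ?sqr_ge0// divr_ge0// ltW.
  by apply: le_trans e1; rewrite lerDr.
apply: (le_trans (ler_wpM2l (ltW s0) le1)).
rewrite RintegralD ?iKZ// !RintegralZl ?iK// !Rintegral_gauss//.
rewrite mulrDr mulrCA sK mulr1 mulrCA.
(* Halving the rate multiplies the mass of the kernel by sqrt 2. *)
have -> : Num.sqrt (a / pi) * Num.sqrt (pi / (a / 2)) = Num.sqrt 2 :> R.
  have -> : pi / (a / 2) = pi / a * 2 :> R by rewrite invfM invrK mulrA.
  by rewrite (sqrtrM 2) ?divr_ge0 ?pi_ge0 ?ltW// mulrA sK mul1r.
have s2 : Num.sqrt 2 <= 2 :> R.
  rewrite -[leRHS](ger0_norm (ler0n _ 2)) -sqrtr_sqr ler_sqrt ?sqr_ge0//.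
  by rewrite expr2 ler_peMr// ler1n.
apply: (@le_trans _ _ (e / 2 + c * 2)); first by rewrite lerD2l ler_wpM2l.
rewrite [leRHS]splitr lerD2l ler_pdivlMr// /c.
rewrite [leLHS](_ : _ = 16 * B / d ^+ 2 / a); last by field; rewrite !gt_eqF.
rewrite ler_pdivrMr// [leRHS]mulrC; apply: le_trans Aa.
by rewrite lerDl.
Qed.

End compact_support.

(** * The product measure and its central limit theorem *)

Section model_identities.
Context {R : realType}.
Implicit Types (beta K t x z b : R) (n : nat).
Local Notation mu := (@lebesgue_measure R).

(** A general [F] lets one computation of the three masses serve the total mass, the generating
    function and the characteristic function. *)
Lemma sum_spin (F : R -> R -> R) beta :
  \sum_y F (spin R y) (rho_beta beta y) =
  F (-1) (expR (- beta) / (1 + 2 * expR (- beta))) +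
  F 0 (1 + 2 * expR (- beta))^-1 +
  F 1 (expR (- beta) / (1 + 2 * expR (- beta))).
Proof.
have ZE : Zrho beta = (1 + 2 * expR (- beta)) / 3.
  rewrite /Zrho !big_ord_recl big_ord0 /rho /spin/=.
  rewrite sub0r subrr (_ : 2%:R - 1 = 1 :> R); last by ring.
  by rewrite sqrrN expr1n !mulr1 expr0n/= mulr0 expR0; field.
have e0 := expR_gt0 (- beta).
have e1 : 1 + 2 * expR (- beta) != 0 by rewrite gt_eqF// addr_gt0// mulr_gt0.
rewrite !big_ord_recl big_ord0 /rho_beta ZE /rho /spin/=.
rewrite sub0r subrr (_ : 2%:R - 1 = 1 :> R); last by ring.
rewrite sqrrN expr1n !mulr1 expr0n/= mulr0 expR0 addr0 addrA.
by congr (F _ _ + F _ _ + F _ _); field.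
Qed.

Lemma rho_beta_gt0 beta y : 0 < rho_beta beta y :> R.
Proof. by rewrite divr_gt0 ?Zrho_gt0// mulr_gt0 ?expR_gt0// invr_gt0. Qed.

Lemma sum_rho_beta beta : \sum_y rho_beta beta y = 1 :> R.
Proof.
rewrite (sum_spin (fun _ r => r)); have e0 := expR_gt0 (- beta).
by field; rewrite gt_eqF// addr_gt0// mulr_gt0.
Qed.

Lemma expR_c beta t :
  expR (c beta t) = \sum_y expR (t * spin R y) * rho_beta beta y.
Proof.
rewrite lnK// posrE (bigD1 ord0)//=.
apply: ltr_pwDl; first by rewrite mulr_gt0 ?expR_gt0 ?rho_beta_gt0.
by apply: sumr_ge0 => y _; rewrite mulr_ge0 ?expR_ge0// ltW// rho_beta_gt0.
Qed.

Lemma sum_prod_mass n beta : \sum_(w : config n) prod_mass beta w = 1 :> R.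
Proof.
rewrite /prod_mass -(bigA_distr_bigA (fun _ => rho_beta beta)) big1// => j _.
exact: sum_rho_beta.
Qed.

Lemma prod_mass_mgf n beta t :
  \sum_(w : config n) expR (t * total_spin w) * prod_mass beta w =
  expR (n%:R * c beta t).
Proof.
rewrite expRM_natl expR_c -[in RHS](card_ord n) -prodr_const.
rewrite (bigA_distr_bigA (fun _ y => expR (t * spin R y) * rho_beta beta y)).
by apply: eq_bigr => w _; rewrite big_split/= -expR_sum mulr_sumr.
Qed.

(* Hubbard-Stratonovich: completing the square linearizes the quadratic
   interaction, so the sum over configurations factorizes. *)
Lemma gibbs_weight_gauss n beta K b x : (0 < n)%N -> 0 < b ->
  \sum_(w : config n) gibbs_weight beta K w *
    expR (- (beta * K * n%:R / b ^+ 2) *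
            (x - total_spin w * b / n%:R) ^+ 2) =
  expR (- n%:R * G beta K (x / b)).
Proof.
move=> n0 b0; have nR : n%:R != 0 :> R by rewrite pnatr_eq0 -lt0n.
have bR : b != 0 by rewrite gt_eqF.
rewrite /G mulNr mulrBr opprB addrC expRD -prod_mass_mgf mulr_sumr.
apply: eq_bigr => w _; rewrite /gibbs_weight mulrAC -expRD mulrA -expRD.
congr (expR _ * _); field.
by rewrite bR.
Qed.

Local Open Scope complex_scope.

(** Independence factorizes the complex exponential, hence the detour through R[i]. The one-spin
    sine sum vanishes by symmetry of [rho_beta], so the characteristic function is real. *)
Lemma prod_mass_charfun n beta t x :
  \sum_(w : config n) prod_mass beta w * cos (t * (x - total_spin w)) =
  cos (t * x) * (\sum_y rho_beta beta y * cos (t * spin R y)) ^+ n.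
Proof.
pose e (u : R) : R[i] := cos u +i* sin u.
have eD u v : e (u + v) = e u * e v.
  by rewrite /e cosD sinD; simpc; rewrite [_ + _ * cos v]addrC; congr (_ +i* _); ring.
have e_sum (I : Type) (s : seq I) (F : I -> R) :
    e (\sum_(i <- s) F i) = \prod_(i <- s) e (F i).
  apply: (big_morph e eD); by rewrite /e cos0 sin0.
have sumE (I : finType) (r u : I -> R) : \sum_i (r i)%:C * e (u i) =
    (\sum_i r i * cos (u i)) +i* (\sum_i r i * sin (u i)).
  elim/big_ind3 : _ => // [x1 x2 x3 y1 y2 y3 -> ->|i _]; first by simpc.
  by rewrite /e; simpc.
set phi := \sum_y rho_beta beta y * cos (t * spin R y).
have phiE : \sum_y (rho_beta beta y)%:C * e (t * spin R y) = phi%:C.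
  rewrite sumE -/phi (sum_spin (fun s r => r * sin (t * s))).
  by rewrite mulr0 sin0 mulr0 addr0 mulrN1 sinN mulr1 mulrN addNr.
have : \sum_(w : config n) (prod_mass beta w)%:C * e (t * total_spin w) = (phi ^+ n)%:C.
  rewrite rmorphXn /= -phiE -[in RHS](card_ord n) -prodr_const.
  rewrite (bigA_distr_bigA (fun _ y => (rho_beta beta y)%:C * e (t * spin R y))).
  apply: eq_bigr => w _; rewrite big_split/= /prod_mass rmorph_prod; congr (_ * _).
  by rewrite -e_sum mulr_sumr.
rewrite sumE => -[cosE sinE].
under eq_bigr do rewrite mulrBr cosB mulrDr [cos _ * _]mulrC [sin _ * _]mulrC !mulrA.
by rewrite big_split/= -!mulr_suml cosE sinE mul0r addr0 mulrC.
Qed.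

End model_identities.

(** * Elementary estimates for characteristic functions *)

Section real_estimates.
Context {R : realType}.
Implicit Types (f df : R -> R) (a b M r x t v : R).

(** The mean value theorem keeps the constant [M]; iterated, it gives Taylor remainders without
    factorials. *)
Lemma norm_le_pow_derive f df M k r : 0 <= M ->
  (forall x, is_derive x 1 f (df x)) -> f 0 = 0 ->
  (forall x, `|x| <= r -> `|df x| <= M * `|x| ^+ k) ->
  forall x, `|x| <= r -> `|f x| <= M * `|x| ^+ k.+1.
Proof.
move=> M0 dfx f0 dfM x xr.
have cf : continuous f by apply: is_derive_continuous => y; exists (df y).
have le_c c : `|c| <= `|x| -> `|df c * x| <= M * `|x| ^+ k.+1.
  move=> cx; rewrite normrM exprSr mulrA ler_wpM2r//.
  apply: (le_trans (dfM _ (le_trans cx xr))).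
  by rewrite ler_wpM2l// lerXn2r ?nnegrE.
have [x0|x0] := leP 0 x.
  have [|c] := @MVT_segment _ f df 0 x x0 (fun c _ => dfx c).
    exact: continuous_subspaceT.
  rewrite in_itv/= f0 !subr0 => /andP[c0 cx] ->.
  by apply: le_c; rewrite !ger0_norm.
have [|c] := @MVT_segment _ f df x 0 (ltW x0) (fun c _ => dfx c).
  exact: continuous_subspaceT.
rewrite in_itv/= f0 !sub0r => /andP[xc c0] /(congr1 -%R); rewrite opprK mulrN opprK => ->.
by apply: le_c; rewrite !ler0_norm ?lerN2// ltW.
Qed.

Lemma cos_taylor2 x : `|cos x - 1 + x ^+ 2 / 2| <= `|x| ^+ 3.
Proof.
have d0 (y : R) : is_derive y 1 (fun y => cos y - 1 + y ^+ 2 / 2) (y - sin y).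
  by apply: is_derive_eq; rewrite /GRing.scale/=; field.
have d1 (y : R) : is_derive y 1 (fun y => y - sin y) (1 - cos y).
  by apply: is_derive_eq; rewrite /GRing.scale/=; ring.
have d2 (y : R) : is_derive y 1 (fun y => 1 - cos y) (sin y).
  by apply: is_derive_eq; rewrite /GRing.scale/=; ring.
have b2 (y : R) : `|y| <= `|x| -> `|1 - cos y| <= 1 * `|y| ^+ 1.
  apply: (norm_le_pow_derive _ d2) => //; first by rewrite cos0 subrr.
  by move=> z _; rewrite mul1r expr0 sin_max.
have b1 (y : R) : `|y| <= `|x| -> `|y - sin y| <= 1 * `|y| ^+ 2.
  by apply: (norm_le_pow_derive _ d1) => //; rewrite sin0 subrr.
rewrite -[leRHS]mul1r; apply: (norm_le_pow_derive _ d0 _ b1) => //.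
by rewrite cos0 subrr expr0n/= mul0r addr0.
Qed.

(** Squeezed between 1 - x and 1 / (1 + x) <= 1 - x + x^2, the latter because (1 + x)(1 - x + x^2) =
    1 + x^3. *)
Lemma expRN_taylor1 x : 0 <= x -> `|expR (- x) - 1 + x| <= x ^+ 2.
Proof.
move=> x0; have := expR_ge1Dx (- x) => e1.
have x1 : 0 < 1 + x by rewrite ltr_wpDr.
have e2 : expR (- x) <= (1 + x)^-1.
  by rewrite expRN lef_pV2 ?posrE ?expR_gt0// expR_ge1Dx.
have e3 : (1 + x)^-1 <= 1 - x + x ^+ 2.
  rewrite -[leLHS]mul1r ler_pdivrMr// -subr_ge0.
  rewrite (_ : _ - _ = x ^+ 3); last by ring.
  by rewrite exprn_ge0.
by rewrite ger0_norm; lra.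
Qed.

Lemma norm_subX_le n a b : `|a| <= 1 -> `|b| <= 1 ->
  `|a ^+ n - b ^+ n| <= n%:R * `|a - b|.
Proof.
move=> a1 b1; rewrite subrXX normrM mulrC ler_wpM2r//.
apply: (le_trans (ler_norm_sum _ _ _)).
rewrite -[X in _ <= X%:R](card_ord n) -sumr_const; apply: ler_sum => i _.
by rewrite normrM !normrX mulr_ile1 ?exprn_ge0// exprn_ile1.
Qed.

(** With s = t / sqrt n the limit is also an n-th power, of exp (- v s^2 / 2). Powers of numbers of
    modulus at most 1 differ by at most n times the difference of the bases, here at most |s|^3 +
    s^4. *)
Lemma cvg_charfun_pow v t : 0 <= v <= 1 ->
  (1 - v + v * cos (t / Num.sqrt n%:R)) ^+ n @[n --> \oo] -->
  expR (- (v / 2) * t ^+ 2).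
Proof.
move=> /andP[v0 v1]; pose s n := t / Num.sqrt n%:R.
have sqrtn_cvg : (Num.sqrt n%:R)^-1 @[n --> \oo] --> (0 : R).
  rewrite -[X in _ --> X]sqrtr0; under eq_fun do rewrite -sqrtrV//.
  by apply: continuous_cvg; [exact: sqrt_continuous|exact: cvg_natV].
suff : (1 - v + v * cos (s n)) ^+ n - expR (- (v / 2) * t ^+ 2) @[n --> \oo] --> 0.
  by move/subr_cvg0.
apply: norm_cvg0; pose c := `|t| ^+ 3 + t ^+ 4.
apply: (@squeeze_cvgr _ _ _ _ (cst 0) (fun n => c * (Num.sqrt n%:R)^-1)).
- near=> n; rewrite normr_ge0/=.
  have n0 : (0 < n)%N by near: n; exact: nbhs_infty_gt.
  have q0 : 0 < Num.sqrt n%:R :> R by rewrite sqrtr_gt0 ltr0n.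
  have q1 : 1 <= Num.sqrt n%:R :> R.
    by rewrite -[leLHS]sqrtr1 ler_sqrt ?ler1n ?ltr0n.
  have q2 : Num.sqrt n%:R ^+ 2 = n%:R :> R by rewrite sqr_sqrtr.
  have -> : expR (- (v / 2) * t ^+ 2) = expR (- (v / 2 * s n ^+ 2)) ^+ n.
    rewrite -expRM_natl /s exprMn exprVn q2; congr expR; field.
    by rewrite pnatr_eq0 -lt0n.
  have y0 : 0 <= v / 2 * s n ^+ 2 by rewrite mulr_ge0 ?sqr_ge0// divr_ge0.
  apply: (le_trans (norm_subX_le _ _ _)).
  + rewrite ler_norml; have := cos_geN1 (s n); have := cos_le1 (s n).
    by move: (cos (s n)) => z z1 z2; apply/andP; split; nra.
  + by rewrite ger0_norm ?expR_ge0// expR_le1 oppr_le0.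
  rewrite (_ : _ - _ = v * (cos (s n) - 1 + s n ^+ 2 / 2) -
    (expR (- (v / 2 * s n ^+ 2)) - 1 + v / 2 * s n ^+ 2)); last by field.
  apply: (@le_trans _ _ (n%:R * (`|s n| ^+ 3 + s n ^+ 4))).
    rewrite ler_wpM2l// (le_trans (ler_normB _ _))// lerD//.
      by rewrite normrM ger0_norm// -[leRHS]mul1r ler_pM// cos_taylor2.
    apply: (le_trans (expRN_taylor1 y0)).
    rewrite exprMn -exprM ler_piMl ?exprn_even_ge0// exprn_ile1//.
      by rewrite divr_ge0.
    by rewrite ler_pdivrMr// mul1r (le_trans v1)// ler1n.
  rewrite /s normrM normfV (ger0_norm (ltW q0)) /c -[X in X * _ <= _]q2.
  move: q0 q1; set q := Num.sqrt _ => q0 q1.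
  rewrite [leLHS](_ : _ = `|t| ^+ 3 / q + t ^+ 4 / q / q); last first.
    by field; rewrite gt_eqF.
  rewrite mulrDl lerD2l ler_pdivrMr// ler_peMr//.
  by rewrite mulr_ge0 ?exprn_even_ge0// invr_ge0 ltW.
- exact: cvg_cst.
- by rewrite -[X in _ --> X](mulr0 c); apply: cvgM => //; exact: cvg_cst.
Unshelve. all: by end_near. Qed.

End real_estimates.

Section central_limit.
Context {R : realType}.
Implicit Types (f h : R -> R) (a beta x u : R).
Local Notation mu := (@lebesgue_measure R).

Lemma Rintegral_fsum (I : finType) (F : I -> R -> R) :
  (forall i, mu.-integrable setT (EFin \o F i)) ->
  \int[mu]_x (\sum_i F i x) = \sum_i \int[mu]_x F i x.
Proof.
move=> iF; suff [] : mu.-integrable setT (EFin \o (fun x => \sum_i F i x)) /\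
  \int[mu]_x (\sum_i F i x) = \sum_i \int[mu]_x F i x by [].
elim: (index_enum I) => [|i s [ih1 ih2]].
  under [in X in X /\ _]eq_fun do rewrite big_nil.
  under [in X in _ /\ X]eq_Rintegral do rewrite big_nil.
  rewrite big_nil; split; first exact: integrable0.
  by rewrite Rintegral_cst// mul0r.
under [in X in X /\ _]eq_fun do rewrite big_cons.
under [in X in _ /\ X]eq_Rintegral do rewrite big_cons.
split; first by have := integrableD measurableT (iF i) ih1.
by rewrite big_cons RintegralD// ih2.
Qed.

(** As the squared spin is 0 or 1, the variance is also the probability of a nonzero spin. *)
Definition spin_variance beta : R :=
  2 * expR (- beta) / (1 + 2 * expR (- beta)).

Lemma spin_variance_itv beta : 0 < spin_variance beta < 1.
Proof.
have e0 := expR_gt0 (- beta); rewrite /spin_variance.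
have e1 : 0 < 1 + 2 * expR (- beta) by rewrite addr_gt0// mulr_gt0.
by rewrite divr_gt0 ?mulr_gt0//= ltr_pdivrMr// mul1r ltrDr.
Qed.

Lemma spin_charfun beta t : \sum_y rho_beta beta y * cos (t * spin R y) =
  1 - spin_variance beta + spin_variance beta * cos t.
Proof.
rewrite (sum_spin (fun s r => r * cos (t * s))) mulrN1 mulr1 mulr0 cosN cos0.
have e0 := expR_gt0 (- beta); rewrite /spin_variance; field.
by rewrite gt_eqF// addr_gt0// mulr_gt0.
Qed.

Lemma prod_mass_ge0 n beta (w : config n) : 0 <= prod_mass beta w :> R.
Proof. by apply: prodr_ge0 => j _; rewrite ltW// rho_beta_gt0. Qed.

Section gaussian_kernel.
Variables (beta : R) (al : R).
Hypothesis al0 : 0 < al.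
Let v := spin_variance beta.
Let X n (w : config n) : R := total_spin w / Num.sqrt n%:R.

(** The central limit theorem for a Gaussian test function. The kernel, of variance 2 al, is an
    average of cosines, so its expectation is an integral of the characteristic function; in the
    limit the variances add up to 2 al + v. *)
Lemma prod_mass_kernel_cvg x :
  \sum_(w : config n) prod_mass beta w * expR (- (4 * al)^-1 * (x - X w) ^+ 2)
    @[n --> \oo] -->
  Num.sqrt (al / (al + v / 2)) * expR (- (4 * (al + v / 2))^-1 * x ^+ 2).
Proof.
have /andP[v0 v1] := spin_variance_itv beta.
have al'0 : 0 < al + v / 2 by rewrite addr_gt0// divr_gt0.
pose ph t n := 1 - v + v * cos (t / Num.sqrt n%:R).
pose f_ n (t : R) := expR (- al * t ^+ 2) * (cos (t * x) * ph t n ^+ n).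
pose f t := expR (- al * t ^+ 2) * (cos (t * x) * expR (- (v / 2) * t ^+ 2)).
have mcos (u : R) : measurable_fun setT (fun t : R => cos (t * u)).
  by apply: (@measurable_is_derive _ _ (fun t => - sin (t * u) * u)) => t;
    apply: is_derive_eq; rewrite /GRing.scale/=; ring.
have icos u : mu.-integrable setT (EFin \o (fun t => expR (- al * t ^+ 2) * cos (t * u))).
  by apply: (@integrable_gaussM _ _ _ 1) => // t; exact: cos_max.
have sal : 0 < Num.sqrt (pi / al) by rewrite sqrtr_gt0 divr_gt0 ?pi_gt0.
have fE n : (0 < n)%N -> Num.sqrt (pi / al) *
   (\sum_(w : config n) prod_mass beta w * expR (- (4 * al)^-1 * (x - X w) ^+ 2)) =
   \int[mu]_t f_ n t.
  move=> n0; rewrite mulr_sumr.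
  transitivity (\sum_(w : config n) \int[mu]_t
      (prod_mass beta w * (expR (- al * t ^+ 2) * cos (t * (x - X w))))).
    by apply: eq_bigr => w _; rewrite RintegralZl// gauss_fourier// mulrCA.
  rewrite -Rintegral_fsum; last first.
    by move=> w; have := integrableZl measurableT (prod_mass beta w) (icos (x - X w)).
  apply: eq_Rintegral => t _; rewrite /f_ /ph -spin_charfun.
  have q0 : Num.sqrt n%:R != 0 :> R by rewrite sqrtr_eq0 -ltNge ltr0n.
  have := prod_mass_charfun n beta (t / Num.sqrt n%:R) (x * Num.sqrt n%:R).
  rewrite [X in cos X * _](_ : _ = t * x); last by field.
  move=> <-; rewrite mulr_sumr; apply: eq_bigr => w _.
  by rewrite mulrCA; congr (_ * (_ * cos _)); rewrite /X; field.
have phb t n : `|ph t n| <= 1.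
  rewrite ler_norml /ph; have := cos_geN1 (t / Num.sqrt n%:R).
  have := cos_le1 (t / Num.sqrt n%:R); move: (cos _) => z z1 z2.
  by apply/andP; split; move: v0 v1; rewrite -/v; nra.
have mf_ n : measurable_fun setT (f_ n).
  apply: measurable_funM; first by case: (gaussian_dominated_gauss al0).
  apply: measurable_funM; first exact: mcos.
  apply: measurable_funX; apply: measurable_funD => //.
  by apply: measurable_funM => //; exact: mcos.
have f_f t : f_ n t @[n --> \oo] --> f t.
  rewrite /f_ /f; apply: cvgM; first exact: cvg_cst.
  apply: cvgM; first exact: cvg_cst.
  by apply: cvg_charfun_pow; rewrite !ltW.
have fb n t : (0 < n)%N -> `|f_ n t| <= 1 * expR (- al * t ^+ 2).
  move=> _; rewrite mul1r normrM ger0_norm ?expR_ge0// ler_piMr ?expR_ge0//.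
  by rewrite normrM normrX mulr_ile1// ?cos_max// exprn_ile1.
have [_ fcvg] := dominated_cvg_Rintegral al0 mf_ f_f fb.
suff -> : Num.sqrt (al / (al + v / 2)) * expR (- (4 * (al + v / 2))^-1 * x ^+ 2) =
    (Num.sqrt (pi / al))^-1 * \int[mu]_t f t.
  have : (Num.sqrt (pi / al))^-1 * \int[mu]_t f_ n t @[n --> \oo] -->
      (Num.sqrt (pi / al))^-1 * \int[mu]_t f t.
    by apply: cvgM; [exact: cvg_cst|exact: fcvg].
  apply: cvg_trans; apply: near_eq_cvg; near=> n.
  by rewrite -fE ?mulKf ?gt_eqF//; near: n; exact: nbhs_infty_gt.
have -> : \int[mu]_t f t = \int[mu]_t (expR (- (al + v / 2) * t ^+ 2) * cos (t * x)).
  apply: eq_Rintegral => t _; rewrite /f mulrCA mulrC -expRD.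
  by congr (expR _ * _); ring.
rewrite gauss_fourier// [RHS]mulrA; congr (_ * _).
rewrite -sqrtrV ?divr_ge0 ?pi_ge0 ?ltW// -sqrtrM ?invr_ge0 ?divr_ge0 ?pi_ge0 ?ltW//.
congr Num.sqrt; have := pi_gt0 R; move: pi => p p0.
by field; rewrite !gt_eqF// addr_gt0// mulr_gt0.
Unshelve. all: by end_near. Qed.

End gaussian_kernel.

Lemma compact_support_gauss_bound h : continuous h -> compactly_supported h ->
  exists2 C, 0 <= C & forall x, `|h x| <= C * expR (- 1 * x ^+ 2).
Proof.
move=> ch csh; have [B B0 hB] := compact_support_bounded ch csh.
have [M hM] := csh; exists (B * expR (M ^+ 2)).
  by rewrite mulr_ge0// expR_ge0.
move=> x; rewrite -mulrA -expRD; have [Mx|xM] := leP M `|x|.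
  by rewrite hM// normr0 mulr_ge0// expR_ge0.
rewrite (le_trans (hB x))// ler_peMr// -[leLHS]expR0 ler_expR mulN1r subr_ge0.
by rewrite -(ger0_norm (sqr_ge0 x)) normrX lerXn2r// ?nnegrE ?ltW// (le_lt_trans _ xM).
Qed.

(** [h] is replaced by its mollification, with an error uniform in the spin sum; for a fixed kernel
    the expectation converges by [prod_mass_kernel_cvg], and the limits [L (u k)] converge as the
    kernel narrows. *)
Lemma prod_mass_clt beta h : continuous h -> compactly_supported h ->
  \sum_(w : config n) prod_mass beta w * h (total_spin w / Num.sqrt n%:R)
    @[n --> \oo] -->
  Num.sqrt (2 * spin_variance beta * pi)^-1 *
    \int[mu]_x (h x * expR (- (2 * spin_variance beta)^-1 * x ^+ 2)).
Proof.
move=> ch csh; have [C C0 hC] := compact_support_gauss_bound ch csh.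
have [B B0 hB] := compact_support_bounded ch csh.
have mh : measurable_fun setT h by exact: continuous_measurable_fun.
have gh : gaussian_dominated h by split=> //; exists C, 1.
have /andP[] := spin_variance_itv beta; set v := spin_variance beta => v0 v1.
pose X n (w : config n) : R := total_spin w / Num.sqrt n%:R.
pose L u := Num.sqrt (u / pi) * \int[mu]_x (h x * expR (- u * x ^+ 2)).
(* The kernel uses al = 1 / (k + 1): its rate is [a k] below, and [u k] is the rate once the spin
   variance has been added. *)
pose u k := (4 * (k.+1%:R^-1 + v / 2))^-1 : R.
have u0 k : 0 < u k.
  by rewrite invr_gt0 mulr_gt0// addr_gt0// ?invr_gt0 ?ltr0n// divr_gt0.
have Lu : L (u k) @[k --> \oo] --> L (2 * v)^-1.
  have ucvg : u k @[k --> \oo] --> (2 * v)^-1.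
    have -> : (2 * v)^-1 = (4 * (0 + v / 2))^-1 by field; rewrite gt_eqF.
    apply: cvgV; first by rewrite add0r mulf_neq0// gt_eqF// divr_gt0.
    apply: cvgM; first exact: cvg_cst.
    apply: cvgD; last exact: cvg_cst.
    by rewrite (cvg_shiftS (fun k => (k%:R : R)^-1)); exact: cvg_natV.
  apply: cvgM.
    apply: continuous_cvg; first exact: sqrt_continuous.
    by apply: cvgM => //; exact: cvg_cst.
  have mf_ k : measurable_fun setT (fun x => h x * expR (- u k * x ^+ 2)).
    by apply: measurable_funM => //; case: (gaussian_dominated_gauss (u0 k)).
  have f_f x : h x * expR (- u k * x ^+ 2) @[k --> \oo] -->
      h x * expR (- (2 * v)^-1 * x ^+ 2).
    apply: cvgM; first exact: cvg_cst.
    apply: continuous_cvg; first exact: continuous_expR.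
    by apply: cvgM; [exact: cvgN|exact: cvg_cst].
  have fb k x : (0 < k)%N ->
      `|h x * expR (- u k * x ^+ 2)| <= C * expR (- 1 * x ^+ 2).
    move=> _; rewrite normrM (le_trans _ (hC x))// ler_piMr//.
    by rewrite ger0_norm ?expR_ge0// expR_le1 mulNr oppr_le0 mulr_ge0 ?sqr_ge0// ltW.
  by have [] := dominated_cvg_Rintegral ltr01 mf_ f_f fb.
pose a k := (4 * (k.+1%:R : R)^-1)^-1.
have a0 k : 0 < a k by rewrite invr_gt0 mulr_gt0.
pose Mol k y := Num.sqrt (a k / pi) * \int[mu]_x (h x * expR (- a k * (x - y) ^+ 2)).
have Mol_cvg k : \sum_(w : config n) prod_mass beta w * Mol k (X n w) @[n --> \oo]
    --> L (u k).
  have k0 : 0 < k.+1%:R^-1 :> R by rewrite invr_gt0.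
  pose f_ n x := h x * \sum_(w : config n) prod_mass beta w * expR (- a k * (x - X n w) ^+ 2).
  pose s := Num.sqrt (k.+1%:R^-1 / (k.+1%:R^-1 + v / 2)).
  pose f x := h x * (s * expR (- u k * x ^+ 2)).
  have ihK (y : R) : mu.-integrable setT (EFin \o (fun x => h x * expR (- a k * (x - y) ^+ 2))).
    apply: gaussian_dominated_integrable.
    exact: gaussian_dominatedM mh hB (gaussian_dominated_shift y (a0 k)).
  have fE n : \sum_(w : config n) prod_mass beta w * Mol k (X n w) =
      Num.sqrt (a k / pi) * \int[mu]_x f_ n x.
    rewrite [X in _ = _ * X](_ : _ = \sum_(w : config n) \int[mu]_x
        (prod_mass beta w * (h x * expR (- a k * (x - X n w) ^+ 2)))); last first.
      rewrite -Rintegral_fsum; last first.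
        by move=> w; have := integrableZl measurableT (prod_mass beta w) (ihK (X n w)).
      by apply: eq_Rintegral => x _; rewrite /f_ mulr_sumr; apply: eq_bigr => w _; rewrite mulrCA.
    by rewrite mulr_sumr; apply: eq_bigr => w _; rewrite RintegralZl// mulrCA.
  have mf_ n : measurable_fun setT (f_ n).
    apply: measurable_funM => //; apply: measurable_sum => w.
    by apply: measurable_funM => //; exact: measurable_gauss.
  have f_f x : f_ n x @[n --> \oo] --> f x.
    by apply: cvgM; [exact: cvg_cst|exact: prod_mass_kernel_cvg].
  have fb n x : (0 < n)%N -> `|f_ n x| <= C * expR (- 1 * x ^+ 2).
    move=> _; rewrite normrM (le_trans _ (hC x))// ler_piMr//.
    rewrite ger0_norm; last by apply: sumr_ge0 => w _; rewrite mulr_ge0 ?prod_mass_ge0 ?expR_ge0.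
    rewrite -(sum_prod_mass n beta); apply: ler_sum => w _.
    rewrite ler_piMr ?prod_mass_ge0// expR_le1 mulNr oppr_le0.
    by rewrite mulr_ge0 ?sqr_ge0// ltW.
  have [_ fcvg] := dominated_cvg_Rintegral ltr01 mf_ f_f fb.
  under eq_fun do rewrite fE.
  have -> : L (u k) = Num.sqrt (a k / pi) * \int[mu]_x f x.
    rewrite /f; under eq_Rintegral do rewrite mulrCA.
    rewrite RintegralZl//; last first.
      apply: gaussian_dominated_integrable.
      exact: gaussian_dominatedM mh hB (gaussian_dominated_gauss (u0 k)).
    rewrite mulrA /L; congr (_ * _); rewrite /s -sqrtrM; last first.
      by rewrite divr_ge0 ?pi_ge0// ltW.
    congr Num.sqrt; rewrite /a /u; have := pi_gt0 R; move: pi => p p0.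
    move: k0; move: (k.+1%:R^-1) => q q0; field.
    by rewrite !gt_eqF// ?addr_gt0// ?mulr_gt0.
  by apply: cvgM; [exact: cvg_cst|exact: fcvg].
have -> : Num.sqrt (2 * v * pi)^-1 * \int[mu]_x (h x * expR (- (2 * v)^-1 * x ^+ 2))
   = L (2 * v)^-1 by rewrite /L -invfM.
apply/cvgrPdist_le => /= e e0.
have e3 : 0 < e / 3 by rewrite divr_gt0.
have [A A0 hA] := mollification_error mh hB
  (fun e e0 => compact_support_unif_continuous ch csh e0) e3.
(* The width of the kernel is fixed first, and only then does [n] grow. *)
have : \forall k \near \oo, A <= a k /\ `|L (2 * v)^-1 - L (u k)| <= e / 3.
  near=> k; split; last by near: k; by move/cvgrPdist_le : Lu; apply.
  rewrite /a invfM invrK mulrC ler_pdivlMr// (le_trans (_ : _ <= k%:R)) ?ler_nat//.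
  by near: k; exact: nbhs_infty_ger.
move=> /filter_ex[k [Ak Lk]].
near=> n; rewrite -(subrKA (L (u k))) [e](_ : _ = e / 3 + (e / 3 + e / 3)); last by field.
rewrite (le_trans (ler_normD _ _))// lerD//.
set E1 := \sum_(w : config n) prod_mass beta w * Mol k (X n w).
rewrite -(subrKA E1) (le_trans (ler_normD _ _))// lerD//.
  by rewrite /E1; near: n; by move/cvgrPdist_le : (Mol_cvg k); apply.
rewrite /E1 -sumrB (le_trans (ler_norm_sum _ _ _))//.
rewrite -[leRHS]mul1r -[X in _ <= X * _](sum_prod_mass n beta) mulr_suml.
apply: ler_sum => w _.
rewrite -mulrBr normrM ger0_norm ?prod_mass_ge0// ler_wpM2l ?prod_mass_ge0//.
exact: hA.
Unshelve. all: by end_near. Qed.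
End central_limit.

(** * Cumulants and the type of the minimum *)

Section cumulants.
Context {R : realType}.
Implicit Types (beta t x : R).

(** [tilt_norm] is 1 + 2 exp (- beta) times the moment generating function of [rho_beta]; dividing
    by it normalizes the law tilted by exp (t y). *)
Definition tilt_norm beta t : R := 1 + expR (- beta) * (expR t + expR (- t)).
Definition tilt_mean beta t : R :=
  expR (- beta) * (expR t - expR (- t)) / tilt_norm beta t.
Definition tilt_sqr beta t : R :=
  expR (- beta) * (expR t + expR (- t)) / tilt_norm beta t.

Lemma tilt_norm_gt0 beta t : 0 < tilt_norm beta t.
Proof. by rewrite addr_gt0// mulr_gt0 ?expR_gt0// addr_gt0 ?expR_gt0. Qed.

Lemma is_derive_tilt_norm beta t : is_derive t 1 (tilt_norm beta)
  (expR (- beta) * (expR t - expR (- t))).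
Proof.
by rewrite /tilt_norm; apply: is_derive_eq; rewrite /GRing.scale/=; ring.
Qed.

Lemma is_derive_tilt_normV beta t :
  is_derive t 1 (fun t => (tilt_norm beta t)^-1)
    (- tilt_mean beta t / tilt_norm beta t).
Proof.
have Z0 := lt0r_neq0 (tilt_norm_gt0 beta t).
apply: is_derive_eq (is_deriveV Z0 (is_derive_tilt_norm beta t)) _.
by rewrite /tilt_mean /GRing.scale/=; field.
Qed.

Lemma is_derive_tilt_mean beta t : is_derive t 1 (tilt_mean beta)
  (tilt_sqr beta t - tilt_mean beta t ^+ 2).
Proof.
have Z0 := lt0r_neq0 (tilt_norm_gt0 beta t).
have dN : is_derive t 1 (fun t => expR (- beta) * (expR t - expR (- t)))
    (expR (- beta) * (expR t + expR (- t))).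
  by apply: is_derive_eq; rewrite /GRing.scale/=; ring.
apply: is_derive_eq (is_deriveM dN (is_derive_tilt_normV beta t)) _.
by rewrite /tilt_sqr /tilt_mean /GRing.scale/=; field.
Qed.

Lemma is_derive_tilt_sqr beta t : is_derive t 1 (tilt_sqr beta)
  (tilt_mean beta t - tilt_mean beta t * tilt_sqr beta t).
Proof.
have Z0 := lt0r_neq0 (tilt_norm_gt0 beta t).
have dN : is_derive t 1 (fun t => expR (- beta) * (expR t + expR (- t)))
    (expR (- beta) * (expR t - expR (- t))).
  by apply: is_derive_eq; rewrite /GRing.scale/=; ring.
apply: is_derive_eq (is_deriveM dN (is_derive_tilt_normV beta t)) _.
by rewrite /tilt_sqr /tilt_mean /GRing.scale/=; field.
Qed.

Lemma cE beta t : c beta t = ln (tilt_norm beta t / (1 + 2 * expR (- beta))).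
Proof.
rewrite /c (sum_spin (fun s r => expR (t * s) * r)) mulrN1 mulr1 mulr0 expR0.
congr ln; rewrite /tilt_norm; field.
by rewrite gt_eqF// addr_gt0// mulr_gt0// expR_gt0.
Qed.

Lemma is_derive_c beta t : is_derive t 1 (c beta) (tilt_mean beta t).
Proof.
have -> : c beta = @ln R \o (fun t => tilt_norm beta t / (1 + 2 * expR (- beta))).
  by apply/funext => u; exact: cE.
have e0 : 0 < 1 + 2 * expR (- beta) by rewrite addr_gt0// mulr_gt0// expR_gt0.
have Z0 := tilt_norm_gt0 beta t.
have d1 := is_derive_tilt_norm beta t.
have d2 := is_derive1_ln (divr_gt0 Z0 e0).
have d3 : is_derive t 1 (fun t => tilt_norm beta t / (1 + 2 * expR (- beta)))
    (expR (- beta) * (expR t - expR (- t)) / (1 + 2 * expR (- beta))).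
  apply: is_derive_eq (is_deriveM d1 (is_derive_cst (1 + 2 * expR (- beta))^-1 t 1)) _.
  by rewrite /GRing.scale/=; ring.
apply: is_derive_eq (@is_derive1_comp _ _ (fun t => tilt_norm beta t / _) _ _ _ d2 d3) _.
by rewrite /tilt_mean; field; rewrite !gt_eqF.
Qed.

(* The derivatives of [c beta], as polynomials in the first two moments
   [p = tilt_mean] and [q = tilt_sqr] of the tilted spin, obtained from
   [p' = q - p ^+ 2] and [q' = p - p * q] (the spin satisfies [y ^+ 3 = y]). *)
Definition cumulant beta (j : nat) t : R :=
  let p := tilt_mean beta t in let q := tilt_sqr beta t in
  match j with
  | 0 => c beta t
  | 1 => p
  | 2 => q - p ^+ 2
  | 3 => p - 3 * p * q + 2 * p ^+ 3
  | 4 => q - 3 * q ^+ 2 - 4 * p ^+ 2 + 12 * p ^+ 2 * q - 6 * p ^+ 4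
  | 5 => p - 15 * p * q + 30 * p * q ^+ 2 + 20 * p ^+ 3 - 60 * p ^+ 3 * q
         + 24 * p ^+ 5
  | 6 => q - 15 * q ^+ 2 + 30 * q ^+ 3 - 16 * p ^+ 2 + 150 * p ^+ 2 * q
         - 270 * p ^+ 2 * q ^+ 2 - 120 * p ^+ 4 + 360 * p ^+ 4 * q
         - 120 * p ^+ 6
  | _ => p - 63 * p * q + 420 * p * q ^+ 2 - 630 * p * q ^+ 3 + 182 * p ^+ 3
         - 1470 * p ^+ 3 * q + 2520 * p ^+ 3 * q ^+ 2 + 840 * p ^+ 5
         - 2520 * p ^+ 5 * q + 720 * p ^+ 7
  end.

(** The restriction reflects the encoding: the last branch of [cumulant] is the seventh derivative
    and is returned for all larger indices too. *)
Lemma is_derive_cumulant beta j t : (j < 7)%N ->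
  is_derive t 1 (cumulant beta j) (cumulant beta j.+1 t).
Proof.
have dp := is_derive_tilt_mean beta t.
have dq := is_derive_tilt_sqr beta t.
case: j => [_|]; first exact: is_derive_c.
case=> [_|]; first exact: dp.
do 5 (case=> [_|];
  first by rewrite /cumulant; apply: is_derive_eq; rewrite /GRing.scale/=; ring).
by [].
Qed.

End cumulants.

(** * Taylor remainders and orders of vanishing *)

Section taylor.
Context {R : realType}.
Implicit Types (f : R -> R) (x a C M : R).

Lemma is_derive_monomial a j x :
  is_derive x 1 (fun y => a * y ^+ j) (a * (j%:R * x ^+ j.-1)).
Proof.
have -> : (fun y => a * y ^+ j) = (fun _ => a) * (id ^+ j : R -> R).
  by apply/funext => y; rewrite !fctE.
apply: is_derive_eq.
by rewrite /GRing.scale/= mulr1 mulr0 addr0.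
Qed.

(** With the derivatives given as a family, the induction drops its first member: the remainder of
    order N + 1 of [F 0] has as derivative the remainder of order N of [F 1]. *)
Lemma taylor_bound N (F : nat -> R -> R) M :
  (forall j x, (j < N)%N -> is_derive x 1 (F j) (F j.+1 x)) -> 0 <= M ->
  (forall x, `|x| <= 1 -> `|F N x| <= M) ->
  forall x, `|x| <= 1 ->
    `|F 0 x - \sum_(j < N) F j 0 / j`!%:R * x ^+ j| <= M * `|x| ^+ N.
Proof.
elim: N F => [|N ih] F dF M0 FM x x1.
  by rewrite big_ord0 subr0 expr0 mulr1 FM.
pose f y := F 0 y - \sum_(j < N.+1) F j 0 / j`!%:R * y ^+ j.
pose df y := F 1 y - \sum_(j < N) F j.+1 0 / j`!%:R * y ^+ j.
apply: (@norm_le_pow_derive _ f df M N 1) => // [y||y y1].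
- have dS : is_derive y 1 (\sum_(j < N.+1) (fun y => F j 0 / j`!%:R * y ^+ j))
      (\sum_(j < N.+1) (F j 0 / j`!%:R * (j%:R * y ^+ j.-1))).
    by apply: is_derive_sum => j; exact: is_derive_monomial.
  have -> : f = F 0 - \sum_(j < N.+1) (fun y => F j 0 / j`!%:R * y ^+ j).
    by apply/funext => z; rewrite /f !fctE fct_sumE.
  apply: is_derive_eq (is_deriveB (dF 0 y isT) dS) _.
  rewrite /df big_ord_recl/= mul0r mulr0 add0r; congr (_ - _).
  apply: eq_bigr => j _; rewrite /bump/= add1n factS natrM.
  have j1 : j.+1%:R != 0 :> R by rewrite pnatr_eq0.
  have jf : j`!%:R != 0 :> R by rewrite pnatr_eq0 -lt0n fact_gt0.
  move: (j.+1%:R : R) j1 (j`!%:R : R) jf => u u0 v v0.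
  by field; rewrite ?u0 ?v0.
- rewrite /f big_ord_recl/= expr0 fact0 divr1 mulr1 big1 ?addr0 ?subrr// => j _.
  by rewrite expr0n mulr0.
- by apply: (ih (fun j => F j.+1)) => // j z jN; apply: dF.
Qed.

Lemma le0_of_le_mul a C : (forall x, 0 < x <= 1 -> a <= C * x) -> a <= 0.
Proof.
move=> aC; rewrite leNgt; apply/negP => a0.
have C0 : 0 < C by rewrite (lt_le_trans a0)// -[C]mulr1 aC// ltr01 lexx.
pose x := Num.min 1 (a / (2 * C)).
have x0 : 0 < x by rewrite lt_min ltr01 divr_gt0// mulr_gt0.
have := aC x; rewrite x0 ge_min lexx => /(_ isT).
have : C * x <= C * (a / (2 * C)) by apply: ler_wpM2l; [exact: ltW|rewrite ge_min lexx orbT].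
have -> : C * (a / (2 * C)) = a / 2 by field; rewrite gt_eqF.
by move=> h1 h2; have := le_trans h2 h1; lra.
Qed.

(** Division by x^r at small x > 0 leaves - a <= C x. This turns the nonnegativity of G into the
    sign of its leading coefficient at 0. *)
Lemma leading_coef_ge0 f a C r : (forall x, 0 <= f x) ->
  (forall x, `|x| <= 1 -> `|f x - a * x ^+ r| <= C * `|x| ^+ r.+1) -> 0 <= a.
Proof.
move=> f0 fa; rewrite -oppr_le0; apply: (@le0_of_le_mul _ C) => x /andP[x0 x1].
have h := fa x; rewrite (gtr0_norm x0) in h.
have h1 := le_trans (ler_norm _) (h x1); have h2 := f0 x.
by rewrite -(ler_pM2r (exprn_gt0 r x0)) mulNr -mulrA -exprS; lra.
Qed.

(** If r < s, the second expansion makes [f] of order x^(r+1), against a > 0. Applied in both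
    directions it makes the type unique. *)
Lemma leading_order_le f a b A B r s : 0 < a ->
  (\forall x \near 0, `|f x - a * x ^+ r| <= A * `|x| ^+ r.+1) ->
  (\forall x \near 0, `|f x - b * x ^+ s| <= B * `|x| ^+ s.+1) -> (s <= r)%N.
Proof.
move=> a0 fa fb; rewrite leqNgt; apply/negP => rs.
have /nbhs_ballP[d /= d0 dP] : \forall x \near (0 : R),
  `|f x - a * x ^+ r| <= A * `|x| ^+ r.+1 /\ `|f x - b * x ^+ s| <= B * `|x| ^+ s.+1.
  by apply: filterS2 fa fb.
suff : a <= 0 by rewrite leNgt a0.
(* Keeps x inside the ball and in (0, 1], where x^s <= x^(r+1). *)
pose d' := Num.min 1 (d / 2).
have d'0 : 0 < d' by rewrite lt_min ltr01 divr_gt0.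
apply: (@le0_of_le_mul _ ((`|A| + (`|b| + `|B|)) * d')) => y /andP[y0 y1].
pose x := d' * y; have x0 : 0 < x by rewrite mulr_gt0.
have x0' := ltW x0.
have xd' : x <= d' by rewrite ler_piMr// ltW.
have x1 : x <= 1 by rewrite (le_trans xd')// ge_min lexx.
have xd : x < d.
  rewrite (le_lt_trans xd')// gt_min; apply/orP; right.
  by rewrite ltr_pdivrMr// ltr_pMr// ltr1n.
have [] := dP x; first by rewrite /ball/= sub0r normrN gtr0_norm.
rewrite (gtr0_norm x0) => h1 h2; rewrite -mulrA -/x -(ler_pM2r (exprn_gt0 r x0)).
rewrite -mulrA -exprS !mulrDl.
have le_s : x ^+ s <= x ^+ r.+1 by rewrite ler_wiXn2l.
have le_s1 : x ^+ s.+1 <= x ^+ r.+1 by rewrite ler_wiXn2l// ltnW.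
have h3 : A * x ^+ r.+1 <= `|A| * x ^+ r.+1.
  by rewrite ler_wpM2r ?ler_norm// exprn_ge0.
have le_norm_mul (e u v : R) : 0 <= u -> u <= v -> e * u <= `|e| * v.
  move=> u0 uv; apply: (@le_trans _ _ (`|e| * u)); last by rewrite ler_wpM2l.
  by rewrite ler_wpM2r// ler_norm.
have h4 : b * x ^+ s <= `|b| * x ^+ r.+1 by rewrite le_norm_mul// exprn_ge0.
have h5 : B * x ^+ s.+1 <= `|B| * x ^+ r.+1 by rewrite le_norm_mul// exprn_ge0.
by move: h1 h2; rewrite !ler_norml => /andP[h1 h1'] /andP[h2 h2']; lra.
Qed.
End taylor.

Section free_energy.
Context {R : realType}.
Variables (beta K : R).
Hypothesis beta0 : 0 < beta.
Hypothesis K0 : 0 < K.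
Implicit Types (x z M : R) (j r : nat).
Local Notation k := (2 * beta * K).
Local Notation v := (spin_variance beta).

(** Closed form of the j-th derivative of [G beta K], correct for j <= 7. *)
Definition dG j z : R :=
  match j with 0 => beta * K * z ^+ 2 | 1 => k * z | 2 => k | _ => 0 end
  - k ^+ j * cumulant beta j (k * z).

Lemma is_derive_dG j x : (j < 7)%N -> is_derive x 1 (dG j) (dG j.+1 x).
Proof.
move=> j7.
have dl : is_derive x 1 (fun z => k * z) k.
  by apply: is_derive_eq; rewrite /GRing.scale/=; ring.
have dc : is_derive x 1 (fun z => - (k ^+ j) * cumulant beta j (k * z))
    (- (k ^+ j.+1) * cumulant beta j.+1 (k * x)).
  have := @is_derive1_comp _ _ (fun z => k * z) _ _ _ (is_derive_cumulant beta (k * x) j7) dl.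
  move=> dcj; apply: is_derive_eq (is_deriveM (is_derive_cst (- (k ^+ j)) x 1) dcj) _.
  rewrite scaler0 addr0 exprSr; move: (cumulant _ _ _) => c1.
  by rewrite /GRing.scale/=; ring.
pose Q i z : R := match i with 0 => beta * K * z ^+ 2 | 1 => k * z | 2 => k | _ => 0 end.
have dQ : is_derive x 1 (Q j) (Q j.+1 x).
  rewrite /Q; clear; case: j => [|[|[|j]]]; apply: is_derive_eq;
    rewrite /GRing.scale/=; ring.
have -> : dG j = Q j + (fun z => - (k ^+ j) * cumulant beta j (k * z)).
  by apply/funext => z; rewrite /dG !fctE mulNr.
by apply: is_derive_eq (is_deriveD dQ dc) _; rewrite /dG mulNr.
Qed.

Lemma dG0E : dG 0 = G beta K.
Proof. by apply/funext => z; rewrite /dG /G expr0 mul1r. Qed.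

Lemma derive1n_G j : (j <= 7)%N -> (G beta K)^`(j)%classic = dG j.
Proof.
elim: j => [_|j ih j7]; first by rewrite derive1n0 dG0E.
rewrite derive1nS ih; last exact: ltnW.
apply/funext => x; rewrite derive1E.
by case: (is_derive_dG x j7).
Qed.

Lemma derive2_c : (c beta)^`(2)%classic = cumulant beta 2.
Proof.
have d1 : (c beta)^`(1)%classic = cumulant beta 1.
  apply/funext => x; rewrite derive1n1 derive1E.
  by case: (@is_derive_cumulant _ beta 0 x isT).
apply/funext => x; rewrite derive1nS d1 derive1E.
by case: (@is_derive_cumulant _ beta 1 x isT).
Qed.

Lemma tilt_mean0 : tilt_mean beta 0 = 0.
Proof. by rewrite /tilt_mean oppr0 subrr mulr0 mul0r. Qed.

Lemma tilt_sqr0 : tilt_sqr beta 0 = v.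
Proof.
rewrite /tilt_sqr /spin_variance /tilt_norm oppr0 expR0.
by congr (_ / _); ring.
Qed.

Lemma c0 : c beta 0 = 0.
Proof.
rewrite cE /tilt_norm oppr0 expR0 [_ * (1 + 1)]mulrC -mulr2n.
by rewrite divff ?ln1// gt_eqF// addr_gt0// mulr_gt0// expR_gt0.
Qed.

Lemma dG_0 : [/\ dG 0 0 = 0, dG 1 0 = 0, dG 3 0 = 0 & dG 5 0 = 0] /\
  [/\ dG 2 0 = k * (1 - k * v), dG 4 0 = - k ^+ 4 * (v * (1 - 3 * v)) &
      dG 6 0 = - k ^+ 6 * (v * (1 - 15 * v + 30 * v ^+ 2))].
Proof.
rewrite /dG !mulr0 /= tilt_mean0 tilt_sqr0 c0; split; split; ring.
Qed.

Lemma continuous_cumulant7 : continuous (cumulant beta 7).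
Proof.
have dp x := is_derive_tilt_mean beta x.
have dq x := is_derive_tilt_sqr beta x.
(* The value of the derivative is left to unification; its existence gives continuity. *)
apply: is_derive_continuous => x; eexists; rewrite /cumulant.
apply: is_derive_eq; reflexivity.
Qed.

Lemma dG_bounded j : (j <= 7)%N ->
  exists2 M, 0 <= M & forall x, `|x| <= 1 -> `|dG j x| <= M.
Proof.
rewrite leq_eqVlt => j7.
have cj : continuous (dG j).
  case/predU1P : j7 => [->|j7]; last first.
    by apply: is_derive_continuous => x; eexists; exact: is_derive_dG.
  move=> x; rewrite /dG; apply: cvgB; first exact: cvg_cst.
  apply: cvgM; first exact: cvg_cst.
  apply: (@continuous_comp _ _ _ (fun z => k * z) (cumulant beta 7)).
    by apply: cvgM; [exact: cvg_cst|exact: cvg_id].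
  exact: continuous_cumulant7.
have [||z zI zM] := @EVT_max R (fun x => `|dG j x|) (-1) 1.
- by rewrite -subr_ge0 opprK.
- by apply: continuous_subspaceT => x; apply: cvg_norm; exact: cj.
exists `|dG j z| => // x x1; apply: zM.
by rewrite in_itv/= -ler_norml.
Qed.

Lemma G_leading r : (r <= 3)%N -> (forall j, (j < r.*2)%N -> dG j 0 = 0) ->
  exists2 M, 0 <= M & forall x, `|x| <= 1 ->
    `|G beta K x - dG r.*2 0 / (r.*2)`!%:R * x ^+ r.*2| <= M * `|x| ^+ r.*2.+1.
Proof.
move=> r3 dG0; have r7 : (r.*2.+1 <= 7)%N by rewrite ltnS (leq_double r 3).
have [M M0 hM] := dG_bounded r7.
exists M => // x x1.
have := @taylor_bound _ _ dG M (fun j x jr => is_derive_dG x (leq_trans jr r7)) M0 hM x x1.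
rewrite big_ord_recr/= big1 ?add0r ?dG0E// => j _.
by rewrite dG0// !mul0r.
Qed.

Hypothesis min0 : global_minima (G beta K) = [set 0].

Lemma G0 : G beta K 0 = 0. Proof. by rewrite -dG0E; case: dG_0 => -[]. Qed.

Lemma G_ge0 x : 0 <= G beta K x.
Proof.
have : global_minima (G beta K) 0 by rewrite min0.
by move/(_ x); rewrite G0.
Qed.

Lemma G_gt0 x : x != 0 -> 0 < G beta K x.
Proof.
move=> x0; rewrite lt_neqAle G_ge0 andbT; apply: contra x0 => /eqP Gx.
suff : global_minima (G beta K) x by rewrite min0 => ->.
by move=> y; rewrite -Gx G_ge0.
Qed.

Lemma dG_leading_ge0 r : (r <= 3)%N -> (forall j, (j < r.*2)%N -> dG j 0 = 0) ->
  0 <= dG r.*2 0.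
Proof.
move=> r3 dG0; have [M M0 hM] := G_leading r3 dG0.
have := leading_coef_ge0 G_ge0 hM.
by rewrite pmulr_lge0// invr_gt0 ltr0n fact_gt0.
Qed.

(** As [dG 2 0] is k (1 - k v), the critical line is where the second derivative of G at 0
    vanishes. *)
Lemma Kc2E : (K = Kc2 beta) <-> k * v = 1.
Proof.
have /andP[v0 v1] := spin_variance_itv beta.
rewrite /Kc2 derive2_c /cumulant tilt_mean0 tilt_sqr0 expr0n subr0; split=> [->|kv].
  by field; rewrite !gt_eqF.
have bv0 : 2 * beta * v != 0 by rewrite gt_eqF// mulr_gt0// mulr_gt0.
by apply: (mulfI bv0); rewrite divff// mulrAC.
Qed.

(** The factor 1 - 3v, which governs the fourth derivative at 0, has the sign of exp beta - 4. *)
Lemma spin_variance_third : (1 - 3 * v < 0) = (beta < beta_c) /\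
  (1 - 3 * v == 0) = (beta == beta_c).
Proof.
have e0 := expR_gt0 (- beta).
have e1 : 0 < 1 + 2 * expR (- beta) by rewrite addr_gt0// mulr_gt0.
have -> : 1 - 3 * v = (1 - 4 * expR (- beta)) / (1 + 2 * expR (- beta)).
  by rewrite /spin_variance; field; rewrite gt_eqF.
have -> : 1 - 4 * expR (- beta) = (expR beta - 4) * expR (- beta).
  by rewrite mulrBl expRxMexpNx_1.
have eb : expR beta_c = 4 :> R by rewrite lnK// posrE.
split.
  by rewrite !pmulr_llt0 ?invr_gt0// subr_lt0 -eb ltr_expR.
rewrite !mulf_eq0 invr_eq0 !(gt_eqF e0) !(gt_eqF e1) !orbF subr_eq0 -eb.
by rewrite (inj_eq (@expR_inj R)).
Qed.

(** Minimality at 0 makes the first nonzero derivative positive. On the critical line this forces 1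
    - 3v <= 0, which rules out beta > beta_c; when v = 1/3 the sixth derivative is 2 k^6 / 9, so no
    further case arises. *)
Lemma G_type_cases : exists r, [/\
  [\/ r = 1%N, r = 2%N | r = 3%N],
  forall j, (j < r.*2)%N -> dG j 0 = 0,
  0 < dG r.*2 0,
  r = 2%N <-> K = Kc2 beta /\ beta < beta_c &
  r = 3%N <-> K = Kc2 beta /\ beta = beta_c].
Proof.
have [[d0 d1 d3 d5] [d2 d4 d6]] := dG_0.
have k0 : 0 < k by rewrite !mulr_gt0.
have /andP[v0 v1] := spin_variance_itv beta.
have [v3lt v3eq] := spin_variance_third.
have [kv|kv] := eqVneq (k * v) 1; last first.
  have z1 j : (j < 1.*2)%N -> dG j 0 = 0 by case: j => [|[|]].
  exists 1%N; split=> //; first by constructor 1.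
  - rewrite lt_neqAle eq_sym (dG_leading_ge0 (r := 1))// andbT d2.
    by apply: mulf_neq0; [exact: lt0r_neq0|rewrite subr_eq0 eq_sym].
  - by split=> // -[/Kc2E /eqP]; rewrite (negbTE kv).
  - by split=> // -[/Kc2E /eqP]; rewrite (negbTE kv).
have d20 : dG 2 0 = 0 by rewrite d2 kv subrr mulr0.
have KKc : K = Kc2 beta by apply/Kc2E.
have z2 j : (j < 2.*2)%N -> dG j 0 = 0 by case: j => [|[|[|[|]]]].
have [bc|bc] := eqVneq beta beta_c; last first.
  have d40 : 0 < dG 4 0.
    rewrite lt_neqAle eq_sym (dG_leading_ge0 (r := 2))// andbT d4.
    apply: mulf_neq0; first by rewrite oppr_eq0 expf_neq0// lt0r_neq0.
    by apply: mulf_neq0; [exact: lt0r_neq0|rewrite v3eq].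
  exists 2%N; split=> //; first by constructor 2.
  - split=> // _; split=> //; rewrite -v3lt.
    move: d40; rewrite d4 mulNr oppr_gt0 pmulr_rlt0 ?exprn_gt0//.
    by rewrite pmulr_rlt0.
  - by split=> // -[_ /eqP]; rewrite (negbTE bc).
have v3 : 1 - 3 * v = 0 by apply/eqP; rewrite v3eq bc.
have d40 : dG 4 0 = 0 by rewrite d4 v3 !mulr0.
have z3 j : (j < 3.*2)%N -> dG j 0 = 0 by case: j => [|[|[|[|[|[|]]]]]].
have v13 : v = 3^-1 by lra.
exists 3%N; split=> //; first by constructor 3.
- by rewrite d6 v13 mulNr oppr_gt0 pmulr_rlt0 ?exprn_gt0//; lra.
- by split=> // -[_]; rewrite bc ltxx.
Qed.

End free_energy.

(** * Limit theorems along compactly supported functions *)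

Section laplace.
Context {R : realType}.
Variables (beta K : R).
Hypothesis beta0 : 0 < beta.
Hypothesis K0 : 0 < K.
Hypothesis min0 : global_minima (G beta K) = [set 0].
Variable r : nat.
Hypothesis r_gt0 : (0 < r)%N.
Hypothesis r_le3 : (r <= 3)%N.
Hypothesis dG_lt : forall j, (j < r.*2)%N -> dG beta K j 0 = 0.
Hypothesis dG_gt0 : 0 < dG beta K r.*2 0.
Implicit Types (x z : R) (h : R -> R).
Local Notation mu := (@lebesgue_measure R).
Local Notation kappa := (dG beta K r.*2 0 / (r.*2)`!%:R).

Let kappa0 : 0 < kappa.
Proof. by rewrite divr_gt0// ltr0n fact_gt0. Qed.

Lemma c_le_norm t : c beta t <= `|t| :> R.
Proof.
rewrite -ler_expR expR_c -[leRHS]mul1r -(sum_rho_beta beta) mulr_suml.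
apply: ler_sum => y _; rewrite mulrC ler_wpM2l//; first exact/ltW/rho_beta_gt0.
rewrite ler_expR.
apply: (le_trans (ler_norm _)); rewrite normrM ler_piMr//.
by case: y => -[|[|[|]]]//= ?; rewrite /spin/= ?sub0r ?normrN ?normr1 ?subrr ?normr0//
  (_ : 2%:R - 1 = 1 :> R) ?normr1//; ring.
Qed.

Lemma G_even z : G beta K (- z) = G beta K z.
Proof.
by rewrite /G sqrrN !cE /tilt_norm mulrN opprK [expR (- _) + _]addrC.
Qed.

Lemma continuous_G : continuous (G beta K).
Proof.
apply: is_derive_continuous => x; exists (dG beta K 1 x).
by rewrite -dG0E; exact: is_derive_dG.
Qed.

(** Three ranges of |z|: the leading Taylor term near 0, a positive minimum on [eta, 4] by
    compactness, and c (t) <= |t| beyond 4. Both alternatives survive the rescaling z = x / b, as n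
    z^(2r) = x^(2r) and n z^2 >= x^2. *)
Lemma G_lower_bound : exists2 del, 0 < del & forall z,
  del * z ^+ r.*2 <= G beta K z \/ del * z ^+ 2 <= G beta K z.
Proof.
have [M M0 hM] := G_leading r_le3 dG_lt.
(* Below [eta] the Taylor remainder is at most half of the leading term. *)
pose eta := Num.min 1 (kappa / (2 * (M + 1))).
have M1 : 0 < M + 1 by rewrite ltr_wpDl.
have eta0 : 0 < eta by rewrite lt_min ltr01 divr_gt0// mulr_gt0.
have eta1 : eta <= 1 by rewrite ge_min lexx.
have [||y yI ym] := @EVT_min R (G beta K) eta 4.
- by rewrite (le_trans eta1)// ler1n.
- by apply: continuous_subspaceT; exact: continuous_G.
have y0 : 0 < y by move: yI; rewrite in_itv/= => /andP[+ _]; exact: lt_le_trans.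
have m0 : 0 < G beta K y by apply: G_gt0 => //; rewrite gt_eqF.
(* One bound per range: the 16 is the maximum of z^2 on the middle one, and for z >= 4 one has G z
   >= beta K (z^2 - 2z) >= beta K z^2 / 2. *)
pose del := Num.min (kappa / 2) (Num.min (G beta K y / 16) (beta * K / 2)).
have bK : 0 < beta * K by rewrite mulr_gt0.
exists del; first by rewrite !lt_min !divr_gt0.
have del1 : del <= kappa / 2 by rewrite ge_min lexx.
have del2 : del <= G beta K y / 16 by rewrite !ge_min lexx orbT.
have del3 : del <= beta * K / 2 by rewrite !ge_min lexx !orbT.
move=> z; wlog z0 : z / 0 <= z.
  move=> H; have [|z0] := leP 0 z; first exact: H.
  have := H (- z); rewrite G_even sqrrN oppr_ge0 -!mul2n !exprM sqrrN.
  by apply; exact: ltW.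
have [ze|ez] := leP z eta.
  left; have z1 := le_trans ze eta1.
  have := hM z; rewrite (ger0_norm z0) => /(_ z1); rewrite ler_distl => /andP[+ _].
  apply: le_trans; rewrite lerBrDr.
  have zr : 0 <= z ^+ r.*2 by rewrite exprn_ge0.
  apply: (@le_trans _ _ (kappa / 2 * z ^+ r.*2 + kappa / 2 * z ^+ r.*2)); last first.
    by rewrite -mulrDl -splitr.
  apply: lerD; first by rewrite ler_wpM2r.
  rewrite exprSr mulrA mulrAC ler_wpM2r//.
  apply: (@le_trans _ _ ((M + 1) * eta)).
    by rewrite ler_pM// lerDl.
  rewrite -ler_pdivlMl// (@le_trans _ _ (kappa / (2 * (M + 1))))//.
    by rewrite ge_min lexx orbT.
  by rewrite invfM mulrA mulrC.
right; have [z4|z4] := leP z 4.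
  apply: (@le_trans _ _ (G beta K y)); last by apply: ym; rewrite in_itv/= z4 ltW.
  apply: (@le_trans _ _ (G beta K y / 16 * 4 ^+ 2)).
    by rewrite ler_pM ?sqr_ge0 ?lerXn2r ?nnegrE// !le_min !divr_ge0 ?ltW.
  by rewrite [leLHS](_ : _ = G beta K y)//; field.
have cz : c beta (2 * beta * K * z) <= 2 * beta * K * z.
  apply: (le_trans (c_le_norm _)); rewrite ger0_norm// mulr_ge0//.
  by rewrite -mulrA mulr_ge0// ltW.
apply: (@le_trans _ _ (beta * K / 2 * z ^+ 2)); first by rewrite ler_wpM2r ?sqr_ge0.
have : 0 <= beta * K * (z * (z - 4)).
  by rewrite !mulr_ge0 ?subr_ge0// ltW.
by rewrite /G; lra.
Qed.

(** [b] is known only through its power, so that both [Num.sqrt n%:R] and a real power of [n] can be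
    substituted. *)
Variable b : nat -> R.
Hypothesis b_gt0 : forall n, (0 < n)%N -> 0 < b n.
Hypothesis b_pow : forall n, (0 < n)%N -> b n ^+ r.*2 = n%:R.

Lemma b_ge1 n : (0 < n)%N -> 1 <= b n.
Proof.
move=> n0; rewrite leNgt; apply/negP => b1.
have : b n ^+ r.*2 < 1 by rewrite exprn_ilt1 ?(ltW (b_gt0 n0))// -?lt0n ?double_gt0.
by rewrite b_pow// ltNge ler1n n0.
Qed.

Lemma bV_cvg : (b n)^-1 @[n --> \oo] --> 0.
Proof.
apply/cvgrPdist_le => /= e e0; near=> n.
have n0 : (0 < n)%N by near: n; exact: nbhs_infty_gt.
rewrite sub0r normrN gtr0_norm ?invr_gt0 ?b_gt0//.
rewrite -[leRHS]invrK lef_pV2 ?posrE ?invr_gt0 ?b_gt0//.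
rewrite -(@ler_pXn2r _ r.*2) ?double_gt0 ?nnegrE ?invr_ge0 ?(ltW e0) ?(ltW (b_gt0 n0))//.
rewrite b_pow//; near: n; exact: nbhs_infty_ger.
Unshelve. all: by end_near. Qed.

Lemma laplace_cvg h B : measurable_fun setT h -> (forall x, `|h x| <= B) ->
  gaussian_dominated (fun x => expR (- (kappa * x ^+ r.*2))) /\
  \int[mu]_x (h x * expR (- n%:R * G beta K (x / b n))) @[n --> \oo] -->
  \int[mu]_x (h x * expR (- (kappa * x ^+ r.*2))).
Proof.
move=> mh hB; have B0 : 0 <= B by rewrite (le_trans _ (hB 0)).
have [del del0 hdel] := G_lower_bound.
have [M M0 hM] := G_leading r_le3 dG_lt.
(* The factor exp del pays for x^(2r) >= x^2 - 1, which makes the majorant Gaussian for every r. *)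
have low n x : (0 < n)%N ->
    expR (- n%:R * G beta K (x / b n)) <= expR del * expR (- del * x ^+ 2).
  move=> n0; rewrite -expRD ler_expR !mulNr lerNl opprD opprK addrC.
  have bn := b_gt0 n0; have b1 := b_ge1 n0.
  case: (hdel (x / b n)) => h1; (apply: (@le_trans _ _ (n%:R * _));
    last by apply: (ler_wpM2l _ h1); rewrite ler0n).
    rewrite expr_div_n b_pow//.
    rewrite [leRHS](_ : _ = del * x ^+ r.*2); last by field; rewrite pnatr_eq0 -lt0n.
    rewrite -[X in _ - X]mulr1 -mulrBr ler_wpM2l ?(ltW del0)// -mul2n exprM.
    have [x1|x1] := leP (x ^+ 2) 1.
      by rewrite (@le_trans _ _ 0) ?subr_le0// exprn_ge0// sqr_ge0.
    by rewrite (@le_trans _ _ (x ^+ 2)) ?gerBl// ler_eXnr// ltW.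
  have b2 : b n ^+ 2 <= n%:R.
    by rewrite -b_pow// ler_weXn2l// (leq_double 1).
  apply: (@le_trans _ _ (del * x ^+ 2)); first by rewrite gerBl ltW.
  rewrite [leRHS](_ : _ = del * x ^+ 2 * (n%:R / b n ^+ 2)); last first.
    by field; rewrite gt_eqF.
  rewrite ler_peMr//; first by rewrite mulr_ge0 ?sqr_ge0// ltW.
  by rewrite ler_pdivlMr ?mul1r// exprn_gt0.
have mG n : measurable_fun setT (fun x => expR (- n%:R * G beta K (x / b n))).
  apply: continuous_measurable_fun => x.
  apply: continuous_comp; last exact: continuous_expR.
  apply: cvgM; first exact: cvg_cst.
  apply: (@continuous_comp _ _ _ (fun x => x / b n) (G beta K)).
    by apply: cvgM; [exact: cvg_id|exact: cvg_cst].
  exact: continuous_G.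
have ptw x : expR (- n%:R * G beta K (x / b n)) @[n --> \oo] --> expR (- (kappa * x ^+ r.*2)).
  apply: continuous_cvg; first exact: continuous_expR.
  under eq_fun do rewrite mulNr; apply: cvgN.
  apply/subr_cvg0; apply: norm_cvg0.
  (* Since n = b^(2r), the Taylor remainder of order 2r + 1 at x / b, multiplied by n, leaves one
     factor 1 / b. *)
  apply: (@squeeze_cvgr _ _ _ _ (cst 0) (fun n => M * `|x| ^+ r.*2.+1 * (b n)^-1)).
  - near=> n; rewrite normr_ge0/=.
    have n0 : (0 < n)%N by near: n; exact: nbhs_infty_gt.
    have bn := b_gt0 n0.
    have z1 : `|x / b n| <= 1.
      rewrite normf_div (gtr0_norm bn); near: n.
      have : `|x| * (b n)^-1 @[n --> \oo] --> 0.
        by rewrite -[X in _ --> X](mulr0 `|x|); apply: cvgM;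
          [exact: cvg_cst|exact: bV_cvg].
      by move/cvgr_le; apply.
    have -> : n%:R * G beta K (x / b n) - kappa * x ^+ r.*2 =
        n%:R * (G beta K (x / b n) - kappa * (x / b n) ^+ r.*2).
      rewrite [RHS]mulrBr; congr (_ - _).
      by rewrite expr_div_n b_pow// mulrCA [n%:R * _]mulrC divfK// pnatr_eq0 -lt0n.
    rewrite normrM normr_nat (le_trans (ler_wpM2l _ (hM _ z1)))//.
    rewrite normf_div (gtr0_norm bn) expr_div_n [b n ^+ _]exprS b_pow//.
    rewrite [leLHS](_ : _ = M * `|x| ^+ r.*2.+1 * (b n)^-1)//.
    have nR : n%:R != 0 :> R by rewrite pnatr_eq0 -lt0n.
    move: (b n) bn (n%:R : R) nR => u u0 w w0.
    by field; rewrite gt_eqF.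
  - exact: cvg_cst.
  - rewrite -[X in _ --> X](mulr0 (M * `|x| ^+ r.*2.+1)).
    by apply: cvgM; [exact: cvg_cst|exact: bV_cvg].
split.
  have lown n x : (0 < n)%N -> `|expR (- n%:R * G beta K (x / b n))| <=
      expR del * expR (- del * x ^+ 2).
    by move=> n0; rewrite ger0_norm ?expR_ge0// low.
  by have [] := dominated_cvg_Rintegral del0 mG ptw lown.
have mf_ n : measurable_fun setT (fun x => h x * expR (- n%:R * G beta K (x / b n))).
  exact: measurable_funM.
have f_f x : h x * expR (- n%:R * G beta K (x / b n)) @[n --> \oo] -->
    h x * expR (- (kappa * x ^+ r.*2)).
  by apply: cvgM; [exact: cvg_cst|exact: ptw].
have fb n x : (0 < n)%N -> `|h x * expR (- n%:R * G beta K (x / b n))| <=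
    B * expR del * expR (- del * x ^+ 2).
  by move=> n0; rewrite normrM -mulrA ler_pM// ger0_norm ?expR_ge0// low.
by have [] := dominated_cvg_Rintegral del0 mf_ f_f fb.
Unshelve. all: by end_near. Qed.

End laplace.

Section limit_theorem.
Context {R : realType}.
Variables (beta K : R).
Hypothesis beta0 : 0 < beta.
Hypothesis K0 : 0 < K.
Hypothesis min0 : global_minima (G beta K) = [set 0].
Variable r : nat.
Hypothesis r_gt0 : (0 < r)%N.
Hypothesis r_le3 : (r <= 3)%N.
Hypothesis dG_lt : forall j, (j < r.*2)%N -> dG beta K j 0 = 0.
Hypothesis dG_gt0 : 0 < dG beta K r.*2 0.
Variable b : nat -> R.
Hypothesis b_gt0 : forall n, (0 < n)%N -> 0 < b n.
Hypothesis b_pow : forall n, (0 < n)%N -> b n ^+ r.*2 = n%:R.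
Implicit Types (x z : R) (h : R -> R).
Local Notation mu := (@lebesgue_measure R).
Local Notation kappa := (dG beta K r.*2 0 / (r.*2)`!%:R).

Let a n := beta * K * n%:R / b n ^+ 2.
Let X n (w : config n) : R := total_spin w * b n / n%:R.

Let a_gt0 n : (0 < n)%N -> 0 < a n.
Proof. by move=> n0; rewrite divr_gt0 ?exprn_gt0 ?b_gt0// !mulr_gt0// ltr0n. Qed.

Let gibbs_mollified n h B : (0 < n)%N -> measurable_fun setT h ->
  (forall x, `|h x| <= B) ->
  \sum_(w : config n) gibbs_weight beta K w *
    \int[mu]_x (h x * expR (- a n * (x - X w) ^+ 2)) =
  \int[mu]_x (h x * expR (- n%:R * G beta K (x / b n))).
Proof.
move=> n0 mh hB.
have ihK y : mu.-integrable setT (EFin \o (fun x => h x * expR (- a n * (x - y) ^+ 2))).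
  apply: gaussian_dominated_integrable.
  exact: gaussian_dominatedM mh hB (gaussian_dominated_shift y (a_gt0 n0)).
transitivity (\int[mu]_x \sum_(w : config n)
    (gibbs_weight beta K w * (h x * expR (- a n * (x - X w) ^+ 2)))).
  rewrite Rintegral_fsum; first by apply: eq_bigr => w _; rewrite RintegralZl.
  by move=> w; have := integrableZl measurableT (gibbs_weight beta K w) (ihK (X w)).
apply: eq_Rintegral => x _; rewrite -gibbs_weight_gauss ?b_gt0// mulr_sumr.
by apply: eq_bigr => w _; rewrite mulrCA.
Qed.

(** The case h = 1 of the mollified identity: each Gaussian integrates to the same constant. *)
Let partition_functionE n : (0 < n)%N ->
  partition_function n beta K * Num.sqrt (pi / a n) =
  \int[mu]_x expR (- n%:R * G beta K (x / b n)).
Proof.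
move=> n0; have := @gibbs_mollified n (cst 1) 1 n0 (measurable_cst _).
under [RHS]eq_Rintegral do rewrite mul1r.
move=> <-; last by move=> x; rewrite normr1.
rewrite /partition_function mulr_suml; apply: eq_bigr => w _.
under eq_Rintegral do rewrite mul1r.
by rewrite Rintegral_gauss ?a_gt0.
Qed.

Let J h : R := \int[mu]_x (h x * expR (- (kappa * x ^+ r.*2))).

Let laplace h B : measurable_fun setT h -> (forall x, `|h x| <= B) ->
  \int[mu]_x (h x * expR (- n%:R * G beta K (x / b n))) @[n --> \oo] --> J h.
Proof.
move=> mh hB.
by have [_] := laplace_cvg beta0 K0 min0 r_gt0 r_le3 dG_lt dG_gt0 b_gt0 b_pow mh hB.
Qed.

Let gd_J : gaussian_dominated (fun x => expR (- (kappa * x ^+ r.*2))).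
Proof.
have h1 x : `|cst 1 x : R| <= 1 by rewrite normr1.
by have [] := laplace_cvg beta0 K0 min0 r_gt0 r_le3 dG_lt dG_gt0 b_gt0 b_pow
  (measurable_cst _) h1.
Qed.

Let J1_cvg : \int[mu]_x expR (- n%:R * G beta K (x / b n)) @[n --> \oo] --> J (cst 1).
Proof.
have h1 x : `|cst 1 x : R| <= 1 by rewrite normr1.
have := laplace (measurable_cst _) h1.
by under eq_fun do under eq_Rintegral do rewrite mul1r.
Qed.

Let J1_gt0 : 0 < J (cst 1).
Proof.
have k0 : 0 <= kappa by rewrite divr_ge0// ltW.
apply: (@lt_le_trans _ _ (\int[mu]_(x in `[0, 1]) expR (- kappa))).
  by rewrite Rintegral_cst//= lebesgue_measure_itv/= lte01 oppr0 adde0 mulr1 expR_gt0.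
rewrite Rintegral_mkcond; apply: le_Rintegral => //.
- have i1 : mu.-integrable `[0, 1] (EFin \o cst (expR (- kappa))).
    apply: continuous_compact_integrable; first exact: segment_compact.
    by apply: continuous_subspaceT => x; exact: cvg_cst.
  by move/integrable_mkcond : i1; rewrite restrict_EFin; apply.
- apply: gaussian_dominated_integrable; move: gd_J; congr gaussian_dominated.
  by apply/funext => x; rewrite mul1r.
move=> x _; rewrite mul1r patchE; case: ifPn => [|_]; last exact: expR_ge0.
rewrite inE/= in_itv/= => /andP[x0 x1].
by rewrite ler_expR lerN2 ler_piMr// exprn_ile1.
Qed.

Let ensemble_mollified_cvg h B : measurable_fun setT h -> (forall x, `|h x| <= B) ->
  \sum_(w : config n) ensemble_mass beta K w *
    (Num.sqrt (a n / pi) * \int[mu]_x (h x * expR (- a n * (x - X w) ^+ 2)))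
  @[n --> \oo] --> J h / J (cst 1).
Proof.
move=> mh hB.
have : \int[mu]_x (h x * expR (- n%:R * G beta K (x / b n))) /
   \int[mu]_x expR (- n%:R * G beta K (x / b n)) @[n --> \oo] --> J h / J (cst 1).
  apply: cvgM; first exact: laplace mh hB.
  by apply: cvgV; [exact: lt0r_neq0|exact: J1_cvg].
apply: cvg_trans; apply: near_eq_cvg; near=> n.
have n0 : (0 < n)%N by near: n; exact: nbhs_infty_gt.
have sE : (Num.sqrt (pi / a n))^-1 = Num.sqrt (a n / pi).
  have h0 : 0 <= pi / a n by rewrite divr_ge0 ?pi_ge0// (ltW (a_gt0 n0)).
  by rewrite -sqrtrV// invfM invrK mulrC.
rewrite -(gibbs_mollified n0 mh hB) -partition_functionE// invfM sE mulrC.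
rewrite mulr_sumr; apply: eq_bigr => w _; rewrite /ensemble_mass.
by ring.
Unshelve. all: by end_near. Qed.

Let ensemble_cvg_J h : (1 < r)%N -> continuous h -> compactly_supported h ->
  \sum_(w : config n) ensemble_mass beta K w * h (X w) @[n --> \oo] -->
  J h / J (cst 1).
Proof.
move=> r1 ch csh.
have [B B0 hB] := compact_support_bounded ch csh.
have mh : measurable_fun setT h by exact: continuous_measurable_fun.
apply/cvgrPdist_le => /= e e0; have e2 : 0 < e / 2 by rewrite divr_gt0.
have [A A0 hA] := mollification_error mh hB
  (fun e e0 => compact_support_unif_continuous ch csh e0) e2.
have /cvgrPdist_le/(_ _ e2) := ensemble_mollified_cvg mh hB.
apply: filter_app; near=> n => hn.
have n0 : (0 < n)%N by near: n; exact: nbhs_infty_gt.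
(* The place where r > 1 enters: b^3 <= b^(2r) = n, so the rate of the added Gaussian is at least
   beta K b and tends to infinity. *)
have aA : A <= a n.
  have bn := b_gt0 n0.
  have b1 : 1 <= b n by exact: (b_ge1 r_gt0 b_gt0 b_pow).
  have bK : 0 < beta * K by rewrite mulr_gt0.
  have : beta * K * b n <= a n.
    rewrite /a -!mulrA !ler_pM2l// ler_pdivlMr ?exprn_gt0// -exprS -b_pow//.
    by rewrite ler_weXn2l// (leq_trans _ (_ : (4 <= r.*2)%N))// (leq_double 2).
  apply: le_trans; rewrite mulrC -ler_pdivrMr//.
  rewrite -[leLHS]invrK -[leRHS]invrK lef_pV2 ?posrE ?invr_gt0 ?divr_gt0//.
  near: n; have := bV_cvg r_gt0 b_gt0 b_pow.
  by move/cvgr_le; apply; rewrite invr_gt0 divr_gt0// mulr_gt0.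
have sum1 : \sum_(w : config n) ensemble_mass beta K w = 1 :> R.
  by rewrite -mulr_suml divff// gt_eqF// partition_function_gt0.
set E1 := \sum_(w : config n) _ in hn.
rewrite -(subrKA E1) [e]splitr (le_trans (ler_normD _ _))// lerD//.
rewrite /E1 -sumrB (le_trans (ler_norm_sum _ _ _))//.
rewrite -[leRHS]mul1r -[X in _ <= X * _]sum1 mulr_suml.
apply: ler_sum => w _.
rewrite -mulrBr normrM ger0_norm ?ensemble_mass_ge0// ler_wpM2l ?ensemble_mass_ge0//.
exact: hA.
Unshelve. all: by end_near. Qed.

Let J1E : J (cst 1) = \int[mu]_x expR (- (kappa * x ^+ r.*2)).
Proof. by apply: eq_Rintegral => x _; rewrite mul1r. Qed.

Lemma gaussian_dominated_expR_pow :
  gaussian_dominated (fun x => expR (- (kappa * x ^+ r.*2))).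
Proof. exact: gd_J. Qed.

Lemma Rintegral_expR_pow_gt0 : 0 < \int[mu]_x expR (- (kappa * x ^+ r.*2)).
Proof. by rewrite -J1E. Qed.

(** This includes r = 1, where the rate is the constant beta K and the limit of Z_n itself
    results. *)
Lemma partition_function_cvg :
  partition_function n beta K * Num.sqrt (pi / (beta * K * n%:R / b n ^+ 2))
    @[n --> \oo] --> \int[mu]_x expR (- (kappa * x ^+ r.*2)).
Proof.
rewrite -J1E; apply: cvg_trans J1_cvg; apply: near_eq_cvg; near=> n.
by rewrite partition_functionE//; near: n; exact: nbhs_infty_gt.
Unshelve. all: by end_near. Qed.

Lemma ensemble_cvg_higher h : (1 < r)%N -> continuous h -> compactly_supported h ->
  \sum_(w : config n) ensemble_mass beta K w * h (total_spin w * b n / n%:R)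
    @[n --> \oo] -->
  \int[mu]_x (h x * ((\int[mu]_y expR (- (kappa * y ^+ r.*2)))^-1 *
    expR (- (kappa * x ^+ r.*2)))).
Proof.
move=> r1 ch csh; have := ensemble_cvg_J r1 ch csh.
rewrite /J mulrC -/(J (cst 1)) J1E -RintegralZl//; last first.
  have [B B0 hB] := compact_support_bounded ch csh.
  apply: gaussian_dominated_integrable; apply: gaussian_dominatedM hB gd_J.
  exact: continuous_measurable_fun.
by under eq_Rintegral do rewrite mulrCA.
Qed.

End limit_theorem.

(** * Gaussian fluctuations when r = 1 *)

Section gaussian_case.
Context {R : realType}.
Variables (beta K : R).
Hypothesis beta0 : 0 < beta.
Hypothesis K0 : 0 < K.
Hypothesis min0 : global_minima (G beta K) = [set 0].
Hypothesis d2_gt0 : 0 < dG beta K 2 0.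
Implicit Types (x z : R) (h : R -> R).
Local Notation mu := (@lebesgue_measure R).

Lemma sigma2E : sigma2 beta K = 2 * beta * K * spin_variance beta / dG beta K 2 0.
Proof.
by rewrite /sigma2 derive1n_G// derive2_c /cumulant tilt_mean0 tilt_sqr0 expr0n subr0.
Qed.

Lemma sigma2_gt0 : 0 < sigma2 beta K.
Proof.
have /andP[v0 v1] := spin_variance_itv beta.
by rewrite sigma2E divr_gt0// mulr_gt0// !mulr_gt0.
Qed.

Lemma normal_pdf_sigma2 : normal_pdf 0 (Num.sqrt (sigma2 beta K)) =
  fun x => Num.sqrt ((2 * sigma2 beta K)^-1 / pi) *
    expR (- (2 * sigma2 beta K)^-1 * x ^+ 2).
Proof.
have s0 := sigma2_gt0.
have -> : sigma2 beta K = (2 * (2 * sigma2 beta K)^-1)^-1.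
  by field; rewrite gt_eqF.
rewrite normal_pdf_expR; last first.
  by rewrite invr_gt0 mulr_gt0// invr_gt0 mulr_gt0// invr_gt0 mulr_gt0.
apply/funext => x; rewrite subr0.
by rewrite (_ : 2 * (2 * (2 * sigma2 beta K)^-1)^-1 = 2 * sigma2 beta K)//; field;
  rewrite gt_eqF.
Qed.

Lemma ensemble_cvg_normal h : continuous h -> compactly_supported h ->
  \sum_(w : config n) ensemble_mass beta K w * h (total_spin w / Num.sqrt n%:R)
    @[n --> \oo] -->
  \int[mu]_x (h x * normal_pdf 0 (Num.sqrt (sigma2 beta K)) x).
Proof.
move=> ch csh; have /andP[] := spin_variance_itv beta.
set v := spin_variance beta => v0 v1.
have bK0 : 0 < beta * K by rewrite mulr_gt0.
have s0 := sigma2_gt0.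
have b_gt0 n : (0 < n)%N -> 0 < Num.sqrt n%:R :> R by rewrite sqrtr_gt0 ltr0n.
have b_pow n : (0 < n)%N -> Num.sqrt n%:R ^+ 1.*2 = n%:R :> R.
  by move=> n0; rewrite sqr_sqrtr.
have z1 j : (j < 1.*2)%N -> dG beta K j 0 = 0.
  by have [[? ? _ _] _] := dG_0 beta K; case: j => [|[|]].
have g0 := d2_gt0; set g := dG beta K 2 0 in g0 *.
(* With k = 2 beta K and g = k (1 - k v), this limit is (1 - k v)^(-1/2). *)
have Zcvg : partition_function n beta K @[n --> \oo] -->
    Num.sqrt (pi / (g / 2)) / Num.sqrt (pi / (beta * K)).
  have := partition_function_cvg beta0 K0 min0 (isT : (0 < 1)%N) isT z1 d2_gt0 b_gt0 b_pow.
  rewrite (_ : \int[mu]_x _ = Num.sqrt (pi / (g / 2))); last first.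
    rewrite -(Rintegral_gauss 0) ?divr_gt0//; apply: eq_Rintegral => x _.
    by rewrite subr0 mulNr.
  move=> H; have : partition_function n beta K *
      Num.sqrt (pi / (beta * K * n%:R / Num.sqrt n%:R ^+ 2)) / Num.sqrt (pi / (beta * K))
      @[n --> \oo] --> Num.sqrt (pi / (g / 2)) / Num.sqrt (pi / (beta * K)).
    by apply: cvgM; [exact: H|exact: cvg_cst].
  apply: cvg_trans; apply: near_eq_cvg; near=> n.
  have n0 : (0 < n)%N by near: n; exact: nbhs_infty_gt.
  by rewrite sqr_sqrtr// mulfK ?pnatr_eq0 -?lt0n// mulfK// gt_eqF// sqrtr_gt0 divr_gt0// pi_gt0.
(* The interaction is moved into the test function, which stays continuous and compactly
   supported. *)
pose h' x := expR (beta * K * x ^+ 2) * h x.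
have ch' : continuous h'.
  move=> x; apply: cvgM; last exact: ch.
  apply: continuous_comp; last exact: continuous_expR.
  by apply: cvgM; [exact: cvg_cst|exact: exprn_continuous].
have csh' : compactly_supported h'.
  by have [M hM] := csh; exists M => x Mx; rewrite /h' hM// mulr0.
have Ncvg := @prod_mass_clt _ beta _ ch' csh'.
(* [sigma2] equals v / (1 - k v), so 1 / (2 sigma2) = 1 / (2v) - beta K; the prefactors match by the
   value of the limit of Z_n. *)
have E : \int[mu]_x (h x * normal_pdf 0 (Num.sqrt (sigma2 beta K)) x) =
    Num.sqrt (2 * v * pi)^-1 * \int[mu]_x (h' x * expR (- (2 * v)^-1 * x ^+ 2)) /
    (Num.sqrt (pi / (g / 2)) / Num.sqrt (pi / (beta * K))).
  have a0 : 0 < (2 * sigma2 beta K)^-1 by rewrite invr_gt0 mulr_gt0.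
  rewrite normal_pdf_sigma2; under eq_Rintegral do rewrite mulrCA.
  rewrite RintegralZl//; last first.
    have [B B0 hB] := compact_support_bounded ch csh.
    apply: gaussian_dominated_integrable.
    apply: gaussian_dominatedM hB (gaussian_dominated_gauss a0).
    exact: continuous_measurable_fun.
  have gE : g = 2 * beta * K * (1 - 2 * beta * K * v).
    by have [_ []] := dG_0 beta K.
  have kv : 1 - 2 * beta * K * v != 0.
    by apply: contraTneq g0 => e; rewrite gE e mulr0 ltxx.
  rewrite [RHS]mulrAC; congr (_ * _).
    have pi0 := pi_gt0 R.
    have h1 : 0 <= pi / (beta * K) by rewrite divr_ge0 ?pi_ge0// ltW.
    have h2 : 0 <= pi / (g / 2) by rewrite divr_ge0 ?pi_ge0// ltW// divr_gt0.
    have h3 : 0 <= (2 * v * pi)^-1 by rewrite invr_ge0 ltW// mulr_gt0// mulr_gt0.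
    rewrite [X in _ = _ * X]invfM invrK -(sqrtrV h2) -sqrtrM ?invr_ge0// -sqrtrM//.
    congr Num.sqrt; rewrite sigma2E -/v -/g.
    by move: pi0; move: (pi : R) => p p0; field; rewrite !gt_eqF.
  apply: eq_Rintegral => x _; rewrite /h' mulrAC mulrC; congr (_ * _).
  rewrite -expRD; congr expR; rewrite sigma2E -/v -/g gE; field.
  by rewrite kv !gt_eqF.
have Q : (\sum_(w : config n) prod_mass beta w * h' (total_spin w / Num.sqrt n%:R)) /
   partition_function n beta K @[n --> \oo] -->
   Num.sqrt (2 * v * pi)^-1 * \int[mu]_x (h' x * expR (- (2 * v)^-1 * x ^+ 2)) /
    (Num.sqrt (pi / (g / 2)) / Num.sqrt (pi / (beta * K))).
  apply: cvgM; first exact: Ncvg.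
  apply: cvgV; last exact: Zcvg.
  by apply: lt0r_neq0; rewrite divr_gt0// sqrtr_gt0 divr_gt0 ?pi_gt0// divr_gt0.
rewrite -E in Q; apply: cvg_trans Q; apply: near_eq_cvg; near=> n.
have n0 : (0 < n)%N by near: n; exact: nbhs_infty_gt.
rewrite mulr_suml; apply: eq_bigr => w _; rewrite /ensemble_mass /gibbs_weight /h'.
have -> : n%:R * beta * K * (total_spin w / n%:R) ^+ 2 =
    beta * K * (total_spin w / Num.sqrt n%:R) ^+ 2.
  rewrite !expr_div_n sqr_sqrtr//; field.
  by rewrite pnatr_eq0 -lt0n.
by ring.
Unshelve. all: by end_near. Qed.

End gaussian_case.

(** * Weak convergence *)

Section weak_convergence.
Context {R : realType}.
Implicit Types (f g : R -> R) (M x : R).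
Local Notation mu := (@lebesgue_measure R).

Definition plateau M x : R := Num.min 1 (Num.max 0 (M + 1 - `|x|)).

Lemma plateau_itv M x : 0 <= plateau M x <= 1.
Proof.
by rewrite /plateau le_min ler01 ge_min lexx !andbT le_max lexx.
Qed.

Lemma plateau1 M x : `|x| <= M -> plateau M x = 1.
Proof.
move=> xM; rewrite /plateau min_l// le_max; apply/orP; right.
by lra.
Qed.

Lemma plateau0 M x : M + 1 <= `|x| -> plateau M x = 0.
Proof. by move=> Mx; rewrite /plateau max_l ?min_r// subr_le0. Qed.

Lemma continuous_plateau M : continuous (plateau M).
Proof.
move=> x.
apply: (@continuous_min _ _ (cst 1) (cst 0 \max (fun x => M + 1 - `|x|))).
  exact: cvg_cst.
apply: continuous_max; first exact: cvg_cst.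
by apply: cvgB; [exact: cvg_cst|apply: cvg_norm; exact: cvg_id].
Qed.

Variables (T : nat -> finType) (m X : forall n, T n -> R).
Arguments m {n} _.
Arguments X {n} _.
Hypothesis m_ge0 : forall n (w : T n), 0 <= m w.
Hypothesis sum_m : forall n, \sum_(w : T n) m w = 1.
Variable d : R -> R.
Hypothesis dgd : gaussian_dominated d.
Hypothesis d_ge0 : forall x, 0 <= d x.
Hypothesis int_d : \int[mu]_x d x = 1.

Lemma plateau_cvg : \int[mu]_x (plateau k%:R x * d x) @[k --> \oo] --> (1 : R).
Proof.
have [md [C [a a0 dC]]] := dgd.
have mf_ k : measurable_fun setT (fun x => plateau k%:R x * d x).
  apply: measurable_funM => //; apply: continuous_measurable_fun.
  exact: continuous_plateau.
have f_f x : plateau k%:R x * d x @[k --> \oo] --> d x.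
  apply: cvg_near_cst; near=> k; rewrite plateau1 ?mul1r//.
  by near: k; exact: nbhs_infty_ger.
have fb k x : (0 < k)%N -> `|plateau k%:R x * d x| <= C * expR (- a * x ^+ 2).
  move=> _; rewrite normrM (le_trans _ (dC x))// ler_piMl//.
  by have /andP[p0 p1] := plateau_itv k%:R x; rewrite ger0_norm.
by have [_] := dominated_cvg_Rintegral a0 mf_ f_f fb; rewrite int_d.
Unshelve. all: by end_near. Qed.

Hypothesis cc_cvg : forall f, continuous f -> compactly_supported f ->
  \sum_(w : T n) m w * f (X w) @[n --> \oo] --> \int[mu]_x (f x * d x).

Lemma compactly_supported_plateau M g :
  compactly_supported (fun x => plateau M x * g x).
Proof. by exists (M + 1) => x Mx; rewrite plateau0// mul0r. Qed.

(** As [d] has mass 1, some cutoff captures nearly all of it; the cutoff is itself an admissible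
    test function, so the finite laws eventually give it nearly all their mass. *)
Lemma tight e : 0 < e -> exists k : nat,
  `|1 - \int[mu]_x (plateau k%:R x * d x)| <= e /\
  \forall n \near \oo, \sum_(w : T n) m w * (1 - plateau k%:R (X w)) <= e.
Proof.
move=> e0; have e2 : 0 < e / 2 by rewrite divr_gt0.
have [k _ /(_ _ (leqnn k)) ke] : \forall k \near \oo,
    `|1 - \int[mu]_x (plateau k%:R x * d x)| <= e / 2.
  by move/cvgrPdist_le : plateau_cvg; apply.
exists k; split; first by rewrite (le_trans ke)// ler_pdivrMr// ler_peMr ?ltW// ltr1n.
have cP := @continuous_plateau k%:R.
have csP : compactly_supported (plateau k%:R).
  by exists (k%:R + 1) => x; exact: plateau0.
have /cvgrPdist_le/(_ _ e2) := cc_cvg cP csP.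
apply: filterS => n ne; under eq_bigr do rewrite mulrBr mulr1.
rewrite sumrB sum_m; apply: le_trans (ler_norm _) _.
rewrite -(subrKA (\int[mu]_x (plateau k%:R x * d x))) [e]splitr.
by rewrite (le_trans (ler_normD _ _))// lerD.
Qed.

Lemma cvg_bounded_continuous g : continuous g ->
  (exists M, forall x, `|g x| <= M) ->
  \sum_(w : T n) m w * g (X w) @[n --> \oo] --> \int[mu]_x (g x * d x).
Proof.
move=> cg [M gM]; have M0 : 0 <= M by rewrite (le_trans _ (gM 0)).
apply/cvgrPdist_le => /= e e0.
(* Cutting [g] off costs at most M e' <= e / 3, both for the finite laws and for the limit. *)
pose e' := e / (3 * (M + 1)).
have e'0 : 0 < e' by rewrite divr_gt0// mulr_gt0// ltr_wpDl.
have Me' : M * e' <= e / 3.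
  have M1 : 0 < M + 1 by rewrite ltr_wpDl.
  rewrite [leLHS](_ : _ = e / 3 * (M / (M + 1))); last by rewrite /e'; field; rewrite gt_eqF.
  rewrite ler_piMr//; first by rewrite divr_ge0// ltW.
  by rewrite ler_pdivrMr// mul1r lerDl.
have e3 : 0 < e / 3 by rewrite divr_gt0.
have [k [ke tk]] := tight e'0.
pose f x := plateau k%:R x * g x.
have cf : continuous f.
  by move=> x; apply: cvgM; [exact: continuous_plateau|exact: cg].
have /cvgrPdist_le/(_ _ e3) := cc_cvg cf (compactly_supported_plateau _ _).
apply: filterS2 tk => n tn fn.
have mg : measurable_fun setT g by exact: continuous_measurable_fun.
have mp : measurable_fun setT (plateau k%:R).
  by apply: continuous_measurable_fun; exact: continuous_plateau.
have mf : measurable_fun setT f by exact: continuous_measurable_fun.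
have pb x : `|plateau k%:R x| <= 1.
  by have /andP[p0 p1] := plateau_itv k%:R x; rewrite ger0_norm.
have fM x : `|f x| <= M by rewrite /f normrM -[leRHS]mul1r ler_pM.
have ig := gaussian_dominated_integrable (gaussian_dominatedM mg gM dgd).
have jf := gaussian_dominated_integrable (gaussian_dominatedM mf fM dgd).
have ip := gaussian_dominated_integrable (gaussian_dominatedM mp pb dgd).
have jd := gaussian_dominated_integrable dgd.
rewrite -(subrKA (\int[mu]_x (f x * d x))) [e](_ : _ = e / 3 + (e / 3 + e / 3)); last by field.
rewrite (le_trans (ler_normD _ _))// lerD//.
  rewrite -RintegralB//.
  apply: (@le_trans _ _ (\int[mu]_x (M * (d x - plateau k%:R x * d x)))).
    have igf : mu.-integrable setT (EFin \o (fun x => g x * d x - f x * d x)).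
      by have := integrableB measurableT ig jf.
    apply: (le_trans (le_normr_Rintegral measurableT igf)); apply: le_Rintegral => //.
    - by have := integrable_norm igf.
    - by have := integrableZl measurableT M (integrableB measurableT jd ip).
    move=> x _; rewrite /f -mulrBl -[X in X - _]mul1r -mulrBl normrM.
    rewrite -[X in _ <= M * (X - _)]mul1r -mulrBl mulrA (ger0_norm (d_ge0 _)).
    rewrite ler_wpM2r// normrM mulrC ler_pM//.
    by have /andP[p0 p1] := plateau_itv k%:R x; rewrite ger0_norm ?subr_ge0.
  rewrite RintegralZl//; last by have := integrableB measurableT jd ip.
  rewrite RintegralB// int_d; apply: le_trans Me'; rewrite ler_wpM2l//.
  by apply: le_trans ke; exact: ler_norm.
rewrite -(subrKA (\sum_(w : T n) m w * f (X w))) (le_trans (ler_normD _ _))// lerD//.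
rewrite -sumrB (le_trans (ler_norm_sum _ _ _))//.
apply: le_trans Me'; apply: le_trans (ler_wpM2l M0 tn).
rewrite mulr_sumr; apply: ler_sum => w _.
rewrite -mulrBr normrM (ger0_norm (m_ge0 _)) mulrCA ler_wpM2l//.
rewrite distrC /f -[X in X - _]mul1r -mulrBl normrM mulrC ler_pM//.
by have /andP[p0 p1] := plateau_itv k%:R (X w); rewrite ger0_norm ?subr_ge0.
Qed.

(** Serves part (a), with [s n] equal to 1 / b n. For |X| < k + 1 continuity of [g] at 0 applies;
    elsewhere the error 2M is weighted by the tight tail. *)
Lemma cvg_rescale g (s : nat -> R) : continuous g ->
  (exists M, forall x, `|g x| <= M) -> s n @[n --> \oo] --> 0 ->
  \sum_(w : T n) m w * g (s n * X w) @[n --> \oo] --> g 0.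
Proof.
move=> cg [M gM] s0; have M0 : 0 <= M by rewrite (le_trans _ (gM 0)).
apply/cvgrPdist_le => /= e e0; have e2 : 0 < e / 2 by rewrite divr_gt0.
have /cvgrPdist_le/(_ _ e2)/nbhs_ballP[/= del del0 gdel] := cg 0.
pose e' := e / 2 / (2 * (M + 1)).
have e'0 : 0 < e' by rewrite divr_gt0// mulr_gt0// ltr_wpDl.
have [k [_ tk]] := tight e'0.
have k0 : 0 < k%:R + 1 :> R by rewrite ltr_wpDl.
have /cvgrPdist_lt/(_ (del / (k%:R + 1))) := s0; rewrite divr_gt0// => /(_ isT).
apply: filterS2 tk => n tn sn.
rewrite -[g 0]mul1r -(sum_m n) mulr_suml -sumrB.
rewrite (le_trans (ler_norm_sum _ _ _))//.
apply: (@le_trans _ _ (\sum_(w : T n) m w * (e / 2 + 2 * M * (1 - plateau k%:R (X w))))).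
  apply: ler_sum => w _; rewrite -mulrBr normrM ger0_norm// ler_wpM2l//.
  have /andP[p0 p1] := plateau_itv k%:R (X w).
  have [Xk|Xk] := leP (k%:R + 1) `|X w|.
    rewrite plateau0// subr0 mulr1; apply: ler_wpDl; first exact: ltW.
    rewrite (le_trans (ler_normB _ _))//.
    by rewrite mulr2n mulrDl mul1r lerD.
  rewrite ler_wpDr ?mulr_ge0 ?subr_ge0//; apply: gdel.
  rewrite /ball/= sub0r normrN normrM; move: sn; rewrite sub0r normrN.
  rewrite ltr_pdivlMr//; apply: le_lt_trans; rewrite ler_wpM2l// ltW//.
under eq_bigr do rewrite mulrDr [X in _ + X]mulrCA.
rewrite big_split/= -mulr_suml -mulr_sumr sum_m mul1r [leRHS]splitr lerD2l.
have M1 : 0 < M + 1 by rewrite ltr_wpDl.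
apply: (@le_trans _ _ (2 * M * e')); first by rewrite ler_wpM2l// mulr_ge0.
rewrite [leLHS](_ : _ = e / 2 * (M / (M + 1))); last by rewrite /e'; field; rewrite gt_eqF.
rewrite ler_piMr//; first by rewrite ltW.
by rewrite ler_pdivrMr// mul1r lerDl.
Qed.

End weak_convergence.

Section density_probability.
Context {R : realType}.
Local Notation mu := (@lebesgue_measure R).
Variable d : R -> R.
Hypothesis dgd : gaussian_dominated d.
Hypothesis d_ge0 : forall x, 0 <= d x.
Hypothesis int_d : \int[mu]_x d x = 1.

(** The proofs are arguments so that the measure and probability structures declared on it can
    depend on them. *)
Definition density_measure (gd : gaussian_dominated d)
    (d0 : forall x, 0 <= d x) (d1 : \int[mu]_x d x = 1)
    (A : set (measurableTypeR R)) : \bar R :=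
  (\int[mu]_(x in A) (d x)%:E)%E.

Local Notation nu := (density_measure dgd d_ge0 int_d).

Let nu0 : nu set0 = 0%E.
Proof. by rewrite /density_measure integral_set0. Qed.

Let nu_ge0 A : (0 <= nu A)%E.
Proof. by rewrite /density_measure integral_ge0// => x _; rewrite lee_fin. Qed.

Let nu_sigma_additive : semi_sigma_additive nu.
Proof.
move=> /= A mA tA mUA.
rewrite /density_measure/= integral_bigcup//=; last first.
  apply: (integrableS _ _ (subsetT _)) => //.
  exact: gaussian_dominated_integrable.
apply: is_cvg_ereal_nneg_natsum_cond => n _ _.
by apply: integral_ge0 => /= x ?; rewrite lee_fin.
Qed.

HB.instance Definition _ := isMeasure.Build _ _ _
  nu nu0 nu_ge0 nu_sigma_additive.

Let nu_setT : nu [set: _] = 1%E.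
Proof.
rewrite /density_measure -[LHS]fineK; first by rewrite -/(Rintegral _ _ _) int_d.
exact/integrable_fin_num/gaussian_dominated_integrable.
Qed.

HB.instance Definition _ :=
  @Measure_isProbability.Build _ _ R nu nu_setT.

Lemma exists_density_probability :
  exists P : probability (measurableTypeR R) R, forall A, measurable A ->
    P A = (\int[mu]_(x in A) (d x)%:E)%E.
Proof. by exists nu. Qed.

End density_probability.

Section integrals.
Context {R : realType}.
Local Notation mu := (@lebesgue_measure R).

(** [nu] is absolutely continuous, and its Radon-Nikodym derivative agrees with [d] almost
    everywhere because their integrals agree on every measurable set. *)
Lemma integral_density (d : R -> R) (nu : probability (measurableTypeR R) R)
    (f : R -> R) M :
  gaussian_dominated d -> (forall x, 0 <= d x) ->
  (forall A : set (measurableTypeR R), measurable A ->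
    nu A = (\int[mu]_(x in A) (d x)%:E)%E) ->
  measurable_fun setT f -> (forall x, `|f x| <= M) ->
  (\int[nu]_x (f x)%:E = (\int[mu]_x (f x * d x))%:E)%E.
Proof.
move=> gd d0 nuE mf fM.
have md : measurable_fun [set: measurableTypeR R] (EFin \o d).
  by apply/measurable_EFinP; case: gd.
have mf' : measurable_fun [set: measurableTypeR R] (EFin \o f).
  exact/measurable_EFinP.
have dom : nu `<< mu.
  apply/null_content_dominatesP => A mA muA0; rewrite nuE//.
  by apply: null_set_integral => //; exact: measurable_funTS.
have intf : nu.-integrable setT (EFin \o f).
  apply: measurable_bounded_integrable => //.
    by rewrite -ge0_fin_numE// fin_num_measure.
  exists M; split; first exact: num_real.
  by move=> y My x _ /=; apply: (le_trans (fM x)); exact: ltW.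
have gi := gaussian_dominated_integrable (gaussian_dominatedM mf fM gd).
transitivity (\int[mu]_x ((f x)%:E * (d x)%:E))%E; last first.
  by rewrite /Rintegral fineK//; exact: integrable_fin_num.
rewrite -(Radon_Nikodym_change_of_variables dom)//=.
apply: ae_eq_integral => //.
- apply: emeasurable_funM; first exact: mf'.
  by apply: (measurable_int mu); exact: Radon_Nikodym_integrable.
- exact: emeasurable_funM.
- apply: ae_eqe_mul2l => /=.
  rewrite Radon_NikodymE//=.
  case: cid => /= h [h1 h2 h3].
  apply: integral_ae_eq => //=.
  by move=> E _ mE; rewrite -h3// nuE.
Qed.

Lemma integral_ensemble n (beta K : R) (f : config n -> R) :
  (\int[ensemble beta K]_w (f w)%:E = (\sum_w ensemble_mass beta K w * f w)%:E)%E.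
Proof.
have i1 w : (ensemble beta K).-integrable setT (EFin \o (\1_[set w] : config n -> R)).
  exact: integrable_indic.
transitivity (\int[ensemble beta K]_w (\sum_v (f v)%:E * (\1_[set v] w)%:E))%E.
  apply: eq_integral => w _; under eq_bigr do rewrite -EFinM.
  rewrite sumEFin (bigD1 w)//= big1 => [|v vw].
    by rewrite indicE mem_set// mulr1 addr0.
  by rewrite indicE memNset ?mulr0//= => /eqP; rewrite eq_sym (negbTE vw).
rewrite integral_sum//; last first.
  by move=> v; apply: integrableZl => //; exact: i1.
rewrite -sumEFin; apply: eq_bigr => v _.
rewrite integralZl//; last exact: i1.
rewrite integral_indic//= setIT EFinM muleC; congr (_ * _)%E.
rewrite /ensemble (bigD1 v)//= big1 => [|w wv].
  by rewrite diracE mem_set// mule1 adde0.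
by rewrite diracE memNset ?mule0//= => /eqP; rewrite (negbTE wv).
Qed.

End integrals.

(** * Type of the minimum and the limit laws *)

Section main.
Context {R : realType}.
Local Notation mu := (@lebesgue_measure R).

Lemma unique_is_type (beta K : R) r M : (0 < r <= 3)%N ->
  0 < dG beta K r.*2 0 ->
  (forall x, `|x| <= 1 ->
    `|G beta K x - dG beta K r.*2 0 / (r.*2)`!%:R * x ^+ r.*2| <=
    M * `|x| ^+ r.*2.+1) ->
  unique (is_type (G beta K) 0) r.
Proof.
move=> /andP[r0 r3] d0 hM.
have r7 : (r.*2 <= 7)%N by rewrite (leq_trans (_ : _ <= 6)%N)// (leq_double r 3).
have near1 : \forall x \near (0 : R), `|x| <= 1.
  by apply: nbhs0_le.
have hMn : \forall x \near 0,
  `|G beta K x - dG beta K r.*2 0 / (r.*2)`!%:R * x ^+ r.*2| <=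
    M * `|x| ^+ r.*2.+1.
  by apply: filterS near1 => x; exact: hM.
split.
  split; rewrite ?mul2n ?derive1n_G//.
  apply/eqO_exP; exists (`|M| + 1); first by rewrite ltr_wpDl.
  apply: filterS hMn => x; rewrite G0 add0r subr0 => /le_trans; apply.
  by rewrite normrX ler_wpM2r ?exprn_ge0// (le_trans (ler_norm M))// lerDl ler01.
move=> s [s0 ds /eqO_exP[k k0 hk]].
(* [s] is not bounded by 3, so its coefficient remains an abstract derivative, of which positivity
   is used. *)
have hs : \forall x \near 0,
    `|G beta K x - (G beta K)^`(2 * s)%classic 0 / (2 * s)`!%:R * x ^+ (2 * s)| <=
    k * `|x| ^+ (2 * s).+1.
  by apply: filterS hk => x; rewrite G0 add0r subr0 normrX.
have f0 (n : nat) : 0 < n`!%:R :> R by rewrite ltr0n fact_gt0.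
apply/eqP; rewrite eqn_leq; apply/andP; split;
  rewrite -leq_double -[s.*2]mul2n.
  by apply: (leading_order_le _ hs hMn); rewrite divr_gt0.
by apply: (leading_order_le _ hMn hs); rewrite divr_gt0.
Qed.

(** The functional [L] covers both limits, evaluation at 0 and integration against a density. *)
Lemma weak_cvg_ensemble (beta K : R) (Y : forall n, {mfun config n >-> measurableTypeR R})
    (nu : probability (measurableTypeR R) R) (L : (R -> R) -> R) :
  (forall g, continuous g -> (exists M, forall x, `|g x| <= M) ->
    (\int[nu]_x (g x)%:E = (L g)%:E)%E /\
    \sum_(w : config n) ensemble_mass beta K w * g (Y n w) @[n --> \oo] --> L g) ->
  weak_cvg (fun n => distribution (@ensemble R n beta K) (Y n)) nu.
Proof.
move=> H g cg bg; have [-> Lg] := H g cg bg.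
have mg : measurable_fun [set: measurableTypeR R] (EFin \o g).
  by apply/measurable_EFinP; exact: continuous_measurable_fun.
have E n : (\int[distribution (@ensemble R n beta K) (Y n)]_x (g x)%:E =
    (\sum_(w : config n) ensemble_mass beta K w * g (Y n w))%:E)%E.
  rewrite integral_distribution//.
    exact: (integral_ensemble beta K (fun w => g (Y n w))).
  have [M gM] := bg; apply: measurable_bounded_integrable => //.
    by rewrite -ge0_fin_numE// fin_num_measure.
  exists M; split; first exact: num_real.
  by move=> y My w _ /=; apply: (le_trans (gM _)); exact: ltW.
by under eq_fun do rewrite E; apply: cvg_EFin; [exact: nearW|].
Qed.

End main.

Theorem theorem6p5 (R : realType) (beta K : R) :
  0 < beta -> 0 < K -> global_minima (G beta K) = [set 0] ->
  exists2 r : nat, unique (is_type (G beta K) 0) r &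
  [/\ [\/ r = 1%N, r = 2%N | r = 3%N],
      weak_cvg (fun n => distribution (@ensemble R n beta K) (@mean_spin R n))
        (\d_(0 : measurableTypeR R)),
      weak_cvg_density
        (fun n => distribution (@ensemble R n beta K)
                    (@scaled_spin R (1 - (2 * r%:R)^-1) n))
        (if r == 1%N then normal_pdf 0 (Num.sqrt (sigma2 beta K))
         else fun x => expR (- ((G beta K)^`(2 * r)%classic 0 * x ^+ (2 * r)
                                  / (2 * r)`!%:R))),
      (r = 2%N <-> K = Kc2 beta /\ beta < beta_c) /\
      (r = 2%N -> (G beta K)^`(4)%classic 0 =
        - (2 * beta * K) ^+ 4 *
          (2 * expR (- beta) * (1 + 2 * expR (- beta)) *
             (1 - 2 * expR (- beta) - 8 * expR (- (2 * beta)))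
           / (1 + 2 * expR (- beta)) ^+ 4)) &
      (r = 3%N <-> K = Kc2 beta /\ beta = beta_c) /\
      (r = 3%N -> (G beta K)^`(6)%classic 0 = 2 * 3 ^+ 4)].
Proof.
move=> beta0 K0 min0.
have [r [r123 dlt dgt r2 r3]] := G_type_cases beta0 K0 min0.
have r03 : (0 < r <= 3)%N by case: r123 => ->.
have /andP[r0 rle3] := r03.
have r7 : (r.*2 <= 7)%N by rewrite (leq_trans (_ : _ <= 6)%N)// (leq_double r 3).
have [M M0 hM] := G_leading rle3 dlt.
exists r; first exact: unique_is_type hM.
pose b n : R := n%:R `^ (2 * r%:R)^-1.
have b_gt0 n : (0 < n)%N -> 0 < b n by move=> n0; apply: powR_gt0; rewrite ltr0n.
have b_pow n : (0 < n)%N -> b n ^+ r.*2 = n%:R.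
  move=> n0; rewrite -powR_mulrn ?powR_ge0// -powRrM -mul2n natrM mulVf ?powRr1//.
  by rewrite mulf_neq0// pnatr_eq0 -lt0n.
pose X n (w : config n) : R := scaled_spin (1 - (2 * r%:R)^-1) w.
have XE n (w : config n) : (0 < n)%N -> X n w = total_spin w * b n / n%:R.
  move=> n0; have nR : n%:R != 0 :> R by rewrite pnatr_eq0 -lt0n.
  have e : n%:R `^ (1 - (2 * r%:R)^-1) * b n = n%:R.
    by rewrite -powRD ?subrK ?powRr1// nR implybT.
  have eV : n%:R^-1 = (n%:R `^ (1 - (2 * r%:R)^-1))^-1 * (b n)^-1.
    by rewrite -invfM e.
  rewrite eV mulrA [_ * b n * _]mulrAC mulfK//.
  by rewrite gt_eqF// b_gt0.
(* Both cases of the limit are packed into one normalized density, so that tightness and parts (a)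
   and (b) are derived once. *)
have [d [gd d0 d1 [dE dcvg]]] : exists d : R -> R, [/\ gaussian_dominated d,
  forall x, 0 <= d x, \int[lebesgue_measure]_x d x = 1 &
  (exists2 a : R, 0 < a & forall x, d x = a *
    (if r == 1%N then normal_pdf 0 (Num.sqrt (sigma2 beta K))
         else fun x => expR (- ((G beta K)^`(2 * r)%classic 0 * x ^+ (2 * r)
                                  / (2 * r)`!%:R))) x) /\
  forall h, continuous h -> compactly_supported h ->
    \sum_(w : config n) ensemble_mass beta K w * h (X n w) @[n --> \oo] -->
    \int[lebesgue_measure]_x (h x * d x)].
  have [r1|r_neq1] := eqVneq r 1%N.
    have d2 : 0 < dG beta K 2 0 by move: dgt; rewrite r1.
    exists (normal_pdf 0 (Num.sqrt (sigma2 beta K))); split.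
    - rewrite normal_pdf_sigma2//.
      have s0 := sigma2_gt0 beta0 K0 d2.
      have a0 : 0 < (2 * sigma2 beta K)^-1 by rewrite invr_gt0 mulr_gt0.
      pose C := Num.sqrt ((2 * sigma2 beta K)^-1 / pi) : R.
      exact: (@gaussian_dominatedM _ (cst C) _ `|C| (measurable_cst _) (fun=> lexx _)
        (gaussian_dominated_gauss a0)).
    - by move=> x; exact: normal_pdf_ge0.
    - by rewrite /Rintegral integral_normal_pdf.
    - split; first by exists 1 => // x; rewrite mul1r.
      move=> h ch csh; apply: cvg_trans (ensemble_cvg_normal beta0 K0 min0 d2 ch csh).
      apply: near_eq_cvg; near=> n; apply: eq_bigr => w _.
      by rewrite /X /scaled_spin r1 mulr1 (_ : 1 - 2^-1 = 2^-1) ?powR12_sqrt//; field.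
  have r1 : (1 < r)%N by rewrite ltn_neqAle eq_sym r_neq1.
  set J := \int[lebesgue_measure]_y expR (- (dG beta K r.*2 0 / (r.*2)`!%:R * y ^+ r.*2)).
  have J0 : 0 < J := Rintegral_expR_pow_gt0 beta0 K0 min0 r0 rle3 dlt dgt b_gt0 b_pow.
  have gJ := gaussian_dominated_expR_pow beta0 K0 min0 r0 rle3 dlt dgt b_gt0 b_pow.
  exists (fun x => J^-1 * expR (- (dG beta K r.*2 0 / (r.*2)`!%:R * x ^+ r.*2))); split.
  - exact: (@gaussian_dominatedM _ (cst J^-1) _ `|J^-1|).
  - by move=> x; rewrite mulr_ge0 ?expR_ge0// invr_ge0 ltW.
  - rewrite RintegralZl//; last exact: gaussian_dominated_integrable.
    by rewrite -/J mulVf// gt_eqF.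
  - split.
      exists J^-1; first by rewrite invr_gt0.
      by move=> x; rewrite mul2n derive1n_G// mulrAC.
    move=> h ch csh.
    have := ensemble_cvg_higher beta0 K0 min0 r0 rle3 dlt dgt b_gt0 b_pow r1 ch csh.
    apply: cvg_trans; apply: near_eq_cvg; near=> n; apply: eq_bigr => w _.
    by rewrite XE//; near: n; exact: nbhs_infty_gt.
have m0 n (w : config n) : 0 <= ensemble_mass beta K w by exact: ensemble_mass_ge0.
have m1 n : \sum_(w : config n) ensemble_mass beta K w = 1 :> R.
  by rewrite -mulr_suml divff// gt_eqF// partition_function_gt0.
split=> //.
- apply: (@weak_cvg_ensemble _ _ _ (fun n => @mean_spin R n) _ (fun g => g 0)) => g cg [B hB].
  split.
    rewrite integral_dirac//; last first.
      by apply/measurable_EFinP; exact: continuous_measurable_fun.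
    by rewrite diracT mul1e.
  (* The mean spin is X divided by [b n]. *)
  have s0 : (b n)^-1 @[n --> \oo] --> 0 := bV_cvg r0 b_gt0 b_pow.
  have bg : exists M, forall x, `|g x| <= M by exists B.
  have := cvg_rescale m0 m1 gd d1 dcvg cg bg s0.
  apply: cvg_trans; apply: near_eq_cvg; near=> n; apply: eq_bigr => w _.
  have n0 : (0 < n)%N by near: n; exact: nbhs_infty_gt.
  rewrite XE// /mean_spin; congr (_ * g _).
  by rewrite mulrC mulrAC mulfK// gt_eqF// b_gt0.
- have [nu nuE] := exists_density_probability gd d0 d1.
  exists nu.
    have [a a0 da] := dE; exists a => // A mA; rewrite nuE//.
    by apply: eq_integral => x _; rewrite da.
  apply: (@weak_cvg_ensemble _ _ _ (fun n => @scaled_spin R (1 - (2 * r%:R)^-1) n) _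
    (fun g => \int[lebesgue_measure]_x (g x * d x))) => g cg [B hB].
  split.
    apply: integral_density hB => //; exact: continuous_measurable_fun.
  apply: (cvg_bounded_continuous m0 m1 gd d0 d1 dcvg cg).
  by exists B.
- split=> // r2'; rewrite derive1n_G//.
  have [_ [_ -> _]] := dG_0 beta K; rewrite /spin_variance.
  have e0 := expR_gt0 (- beta).
  rewrite (_ : expR (- (2 * beta)) = expR (- beta) ^+ 2); last first.
    by rewrite -expRM_natl mulrN.
  rewrite !mulNr; congr (- (_ * _)); move: (expR (- beta)) e0 => e e0.
  by field; rewrite gt_eqF// addr_gt0// mulr_gt0.
- split=> // r3'; rewrite derive1n_G//.
  have [_ [_ _ ->]] := dG_0 beta K.
  have [Kc bc] := r3.1 r3'.
  have kv := (Kc2E K beta0).1 Kc.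
  (* At the tricritical point v = 1/3, and k v = 1 then gives k = 3, whence 2 k^6 / 9 = 2 * 3^4. *)
  have v3 : spin_variance beta = 3^-1.
    have [_ /esym] := spin_variance_third beta.
    by rewrite bc eqxx => /esym/eqP; lra.
  have k3 : 2 * beta * K = 3 by move: kv; rewrite v3; lra.
  by rewrite k3 v3; field.
Unshelve. all: by end_near. Qed.
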